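(* Fix $\kappa\in[1,\infty)$ and let $P^{\rm c}_{\kappa,\rm s},P^{\rm c}_{\kappa,\rm w},P_{\kappa,\rm s},P_{\kappa,\rm w}\subset[1,\infty]$ satisfy: (i) each is of the form $\{\infty\}$, $[p_0,\infty]$ or $(p_0,\infty]$ for some $p_0\in[1,\infty)$; (ii) $P_{\kappa,\rm s}\subset P^{\rm c}_{\kappa,\rm s}$, $P_{\kappa,\rm w}\subset P^{\rm c}_{\kappa,\rm w}$, $P^{\rm c}_{\kappa,\rm s}\subset P^{\rm c}_{\kappa,\rm w}\subset\overline{P^{\rm c}_{\kappa,\rm s}}$, $P_{\kappa,\rm s}\subset P_{\kappa,\rm w}\subset\overline{P_{\kappa,\rm s}}$ (closure in $\mathbb R\cup\{\infty\}$); (iii) if $\kappa\ge2$ then $P^{\rm c}_{\kappa,\rm w}=[1,\infty]$; (iv) if $\kappa\ge3$ then $P_{\kappa,\rm w}=[1,\infty]$. Then there is a nondoubling metric measure space $\mathfrak Z$ such that $\mathcal M^{\rm c}_{\kappa,\mathfrak Z}$ is of strong (respectively weak) type $(p,p)$ iff $p\in P^{\rm c}_{\kappa,\rm s}$ (respectively $p\in P^{\rm c}_{\kappa,\rm w}$), and $\mathcal M_{\kappa,\mathfrak Z}$ is of strong (respectively weak) type $(p,p)$ iff $p\in P_{\kappa,\rm s}$ (respectively $p\in P_{\kappa,\rm w}$).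
   Context: Metric measure space $(X,\rho,\mu)$: nonempty set, metric, nonnegative Borel measure, every open ball $B(x,s)$ having finite strictly positive measure; doubling means $\mu(B(x,2s))\le C\mu(B(x,s))$ uniformly. For $\kappa\ge1$, the modified maximal operators are $\mathcal M^{\rm c}_{\kappa}f(x)=\sup_{s>0}\mu(B(x,\kappa s))^{-1}\int_{B(x,s)}|f|d\mu$ and $\mathcal M_\kappa f(x)=\sup\{\mu(B(y,\kappa s))^{-1}\int_{B(y,s)}|f|d\mu : y\in X,\ s>0,\ x\in B(y,s)\}$. Strong type $(p,p)$: bounded on $L^p$; weak type $(p,p)$ for $p<\infty$: $\lambda\mu(\{|Tf|>\lambda\})^{1/p}\lesssim\|f\|_p$ uniformly; weak type $(\infty,\infty)$ means bounded on $L^\infty$. *)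

(* Defs.v *)
From HB Require Import structures.
From mathcomp Require Import all_boot all_order all_algebra.
From mathcomp Require Import all_classical all_reals all_analysis.
Set Implicit Arguments. Unset Strict Implicit. Unset Printing Implicit Defensive.
Import Order.TTheory GRing.Theory Num.Theory.
Local Open Scope classical_set_scope.
Local Open Scope ring_scope.

Section MMS.
Context {R : realType} {d : measure_display} {X : measurableType d}.
Implicit Types (rho : X -> X -> R) (mu : {measure set X -> \bar R}).

Definition mball rho (x : X) (s : R) : set X := [set y | rho x y < s].

Definition is_metric rho : Prop :=
  [/\ forall x y, 0 <= rho x y,
      forall x y, rho x y = 0 <-> x = y,
      forall x y, rho x y = rho y x &
      forall x y z, rho x z <= rho x y + rho y z].

Definition rho_open rho (U : set X) : Prop :=
  forall x, U x -> exists2 s : R, 0 < s & mball rho x s `<=` U.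

Definition metric_measure_space rho mu : Prop :=
  [/\ exists x : X, True,
      is_metric rho,
      @measurable d X = <<s [set U | rho_open rho U] >> &
      forall x s, 0 < s -> (0 < mu (mball rho x s) < +oo)%E].

Definition doubling rho mu : Prop :=
  exists C : R, forall x s, 0 < s ->
    (mu (mball rho x (2 * s)) <= C%:E * mu (mball rho x s))%E.

Definition kavg rho mu (kappa : R) (f : X -> R) (y : X) (s : R) : \bar R :=
  (((fine (mu (mball rho y (kappa * s))))^-1)%:E *
     \int[mu]_(z in mball rho y s) (`|f z|)%:E)%E.

Definition Mc rho mu (kappa : R) (f : X -> R) (x : X) : \bar R :=
  ereal_sup [set kavg rho mu kappa f x s | s in [set s : R | 0 < s]].

Definition Mnc rho mu (kappa : R) (f : X -> R) (x : X) : \bar R :=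
  ereal_sup [set kavg rho mu kappa f ys.1 ys.2 |
     ys in [set ys : X * R | 0 < ys.2 /\ rho ys.1 x < ys.2]].

Definition in_Lp mu (p : \bar R) (f : X -> R) : Prop :=
  measurable_fun setT f /\ ('N[mu]_p[EFin \o f] < +oo)%E.

Definition strong_type mu (T : (X -> R) -> X -> \bar R) (p : \bar R) : Prop :=
  exists C : R, forall f, in_Lp mu p f ->
    ('N[mu]_p[T f] <= C%:E * 'N[mu]_p[EFin \o f])%E.

Definition weak_type mu (T : (X -> R) -> X -> \bar R) (p : \bar R) : Prop :=
  match p with
  | r%:E => exists C : R, forall f, in_Lp mu p f -> forall lam : R, 0 < lam ->
      (lam%:E * (mu [set x | lam%:E < T f x]) `^ r^-1
         <= C%:E * 'N[mu]_p[EFin \o f])%E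
  | _ => strong_type mu T p
  end.

End MMS.

Definition admissible_exponent_set {R : realType} (P : set (\bar R)) : Prop :=
  P = [set +oo%E] \/
  exists p0 : R, 1 <= p0 /\
    (P = [set p | (p0%:E <= p)%E] \/ P = [set p | (p0%:E < p)%E]).

(* Main.v *)
(* The space is a countable union of finite blocks of diameter less than 1 at
   mutual distance 1, with the block masses normalized to be summable. A ball of
   radius at most 1 stays in its block, a larger one is the whole space, and
   averaging over a space of finite mass is harmless on every L^p. Hence each
   operator is of strong (weak) type (p, p) if and only if its restrictions to
   the blocks are so uniformly. Interleaving families of blocks intersects the
   sets of good exponents, so it suffices to treat the two operators separately.

   All blocks are stars: a centre of mass 1, leaves of mass at least 1, and light
   points of total mass 1. When each leaf shares with the centre a small ball
   whose dilation does not meet the other leaves, the operator sends the Dirac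
   function of the centre to about 1/w at a leaf of mass w, so strong type
   amounts to bounding the sums of w^(1-p) over the leaves, and every admissible
   pair of exponent sets is obtained by choosing the leaf masses. Centring the
   ball at the leaf is possible for kappa < 2. For kappa < 3 it can be centred at
   a light point halfway between the centre and the leaf, which leaves the
   centred operator bounded on every L^p. For larger kappa only the failure of the
   strong type (1, 1) is needed, and nested leaves at distances growing
   geometrically, with masses growing fast, provide it: once more with a ball
   centred at the leaf, or at a light point, in which case a centred ball
   reaching the centre has a dilation containing the much heavier next leaf. *)

Require Import Defs.
From HB Require Import structures.
From mathcomp Require Import all_boot all_order all_algebra.
From mathcomp Require Import all_classical all_reals all_analysis.
From mathcomp Require Import ring lra.
Import Order.TTheory GRing.Theory Num.Theory.
Local Open Scope classical_set_scope.
Local Open Scope ring_scope.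

(** * Finite blocks and kernel bounds *)

Section powers.
Context {R : realType}.
Implicit Types (x t p : R).

(** If [x > t], then [(x / t) ^ (p - 1) >= 1] and the second term alone dominates [x]. With a
    suitable [t] this yields Jensen's inequality up to a constant, for sums and for integrals. *)
Lemma le_add_powR x t p : 0 <= x -> 0 < t -> 1 <= p ->
  x <= t + t `^ (1 - p) * x `^ p.
Proof.
move=> x0 t0 p1; have [xt|tx] := leP x t.
  by rewrite (le_trans xt)// lerDl mulr_ge0// powR_ge0.
have xp : 0 < x by exact: lt_trans tx.
apply: (@le_trans _ _ (t `^ (1 - p) * x `^ p)); last by rewrite lerDr ltW.
have -> : 1 - p = - (p - 1) by rewrite opprB.
rewrite powRN ler_pdivlMl ?powR_gt0// mulrC.
rewrite -(mulr_powRB1 x0 (lt_le_trans ltr01 p1)).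
by rewrite ler_wpM2l// ge0_ler_powR ?nnegrE ?subr_ge0// ltW.
Qed.

Lemma powRK x p : 0 <= x -> p != 0 -> (x `^ p) `^ p^-1 = x.
Proof. by move=> x0 p0; rewrite -powRrM mulfV// powRr1. Qed.

Lemma powRVK x p : 0 <= x -> p != 0 -> (x `^ p^-1) `^ p = x.
Proof. by move=> x0 p0; rewrite -powRrM mulVf// powRr1. Qed.

Lemma powR_addl_le x y p : 0 <= x -> 0 <= y -> 1 <= p ->
  (x + y) `^ p <= 2 `^ p * (x `^ p + y `^ p).
Proof.
move=> x0 y0 p1.
have p0 : 0 <= p by exact: le_trans p1.
wlog xy : x y x0 y0 / x <= y.
  move=> H; have [|/ltW] := leP x y; first exact: H.
  by move=> yx; rewrite addrC [X in _ * X]addrC; exact: H.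
apply: (@le_trans _ _ ((2 * y) `^ p)).
  by rewrite ge0_ler_powR ?nnegrE ?addr_ge0 ?mulr_ge0// mulr2n mulrDl mul1r lerD2r.
by rewrite powRM// ler_wpM2l ?powR_ge0// lerDr powR_ge0.
Qed.

(* Jensen's inequality up to a factor 2: [le_add_powR] with [t] the p-mean. *)
Lemma wmean_le (I : finType) (P : pred I) (a f : I -> R) p : 1 <= p ->
  (forall i, P i -> 0 <= a i) -> (forall i, 0 <= f i) -> \sum_(i | P i) a i <= 1 ->
  \sum_(i | P i) a i * f i <= 2 * (\sum_(i | P i) a i * f i `^ p) `^ p^-1.
Proof.
move=> p1 a0 f0 a1.
have p0 : 0 < p by exact: lt_le_trans p1.
set A := \sum_(i | P i) a i * f i `^ p.
have A0 : 0 <= A by apply: sumr_ge0 => i Pi; rewrite mulr_ge0 ?a0 ?powR_ge0.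
have [Aeq0|An0] := eqVneq A 0.
  rewrite big1 ?mulr_ge0 ?powR_ge0// => i Pi.
  have /eqP : a i * f i `^ p = 0.
    move: Aeq0; rewrite /A => /eqP; rewrite psumr_eq0.
      by move=> /allP/(_ i (mem_index_enum _)); rewrite Pi => /eqP.
    by move=> j Pj; rewrite mulr_ge0 ?a0 ?powR_ge0.
  rewrite mulf_eq0 => /orP[/eqP->|]; first by rewrite mul0r.
  by rewrite powR_eq0 => /andP[/eqP-> _]; rewrite mulr0.
have Apos : 0 < A by rewrite lt_def An0.
set t := A `^ p^-1; have t0 : 0 < t by exact: powR_gt0.
apply: (@le_trans _ _ (\sum_(i | P i) (a i * t + t `^ (1 - p) * (a i * f i `^ p)))).
  apply: ler_sum => i Pi.
  rewrite mulrCA -mulrDr ler_wpM2l ?a0//; exact: le_add_powR.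
rewrite big_split/= -mulr_suml -mulr_sumr -/A.
have -> : t `^ (1 - p) * A = t.
  rewrite -[X in _ * X](@powRVK A p) ?gt_eqF ?ltW// -/t.
  rewrite -powRD ?subrK ?powRr1 ?(ltW t0)//.
  by rewrite oner_eq0.
by rewrite mulr2n mulrDl mul1r lerD2r -[leRHS]mul1r ler_wpM2r// ltW.
Qed.

Lemma wmean_powR_le (I : finType) (P : pred I) (a f : I -> R) p : 1 <= p ->
  (forall i, P i -> 0 <= a i) -> (forall i, 0 <= f i) -> \sum_(i | P i) a i <= 1 ->
  (\sum_(i | P i) a i * f i) `^ p <= 2 `^ p * \sum_(i | P i) a i * f i `^ p.
Proof.
move=> p1 a0 f0 a1.
have p0 : 0 < p by exact: lt_le_trans p1.
have A0 : 0 <= \sum_(i | P i) a i * f i `^ p.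
  by apply: sumr_ge0 => i Pi; rewrite mulr_ge0 ?a0 ?powR_ge0.
apply: (@le_trans _ _ ((2 * (\sum_(i | P i) a i * f i `^ p) `^ p^-1) `^ p)).
  rewrite ge0_ler_powR ?nnegrE ?(ltW p0)//.
  - by apply: sumr_ge0 => i Pi; rewrite mulr_ge0 ?a0.
  - by rewrite mulr_ge0// powR_ge0.
  - exact: wmean_le.
by rewrite powRM ?powR_ge0// powRVK// gt_eqF.
Qed.

End powers.

(** [origin] witnesses nonemptiness. The strict diameter bound allows distinct blocks to be placed
    at distance 1. *)
Record block (R : realType) := Block {
  pt : finType;
  origin : pt;
  wt : pt -> R;
  dist : pt -> pt -> R;
  wt_gt0 : forall x, 0 < wt x;
  dist_refl : forall x, dist x x = 0;
  dist_gt0 : forall x y, x != y -> 0 < dist x y;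
  dist_sym : forall x y, dist x y = dist y x;
  dist_tri : forall x y z, dist x z <= dist x y + dist y z;
  dist_lt1 : forall x y, dist x y < 1 }.
Arguments wt {R b}.
Arguments dist {R b}.
Arguments pt {R}.
Arguments origin {R}.
Arguments wt_gt0 {R b}.
Arguments dist_refl {R b}.
Arguments dist_gt0 {R b} [x y].
Arguments dist_sym {R b}.
Arguments dist_tri {R b}.
Arguments dist_lt1 {R b}.

(** * Strong and weak type inequalities on a single block *)

Section block_operators.
Context {R : realType} (kappa : R) (kappa_ge1 : 1 <= kappa).
Implicit Types (B : block R) (cent : bool) (p C : R).

Definition mass {B} (A : pred (pt B)) : R := \sum_(z | A z) wt z.

Definition bball {B} (y : pt B) (s : R) : pred (pt B) := fun z => dist y z < s.

(** The balls competing in the supremum at [x], for the centred operator if [cent] and for the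
    noncentred one otherwise, so that both are treated together. *)
Definition relevant cent {B} (x y : pt B) (s : R) :=
  if cent then y == x else dist y x < s.

(** [h] dominates the maximal function of [f], stated without suprema or quotients. *)
Definition majorant B cent (f h : pt B -> R) := forall x y s,
  0 < s -> relevant cent x y s ->
  \sum_(z | bball y s z) wt z * f z <= h x * mass (bball y (kappa * s)).

Definition bstrong B cent p C := forall f : pt B -> R, (forall x, 0 <= f x) ->
  exists h : pt B -> R, [/\ forall x, 0 <= h x, majorant B cent f h &
    \sum_x wt x * h x `^ p <= C * \sum_x wt x * f x `^ p].

Definition bweak B cent p C := forall f : pt B -> R, (forall x, 0 <= f x) ->
  exists h : pt B -> R, [/\ forall x, 0 <= h x, majorant B cent f h &
    forall lam, 0 < lam -> lam `^ p * \sum_(x | lam < h x) wt x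
                           <= C * \sum_x wt x * f x `^ p].

(** Here [h] is a minorant of the maximal function, witnessed by single balls. The condition
    [kappa * s <= 1] keeps the dilated ball inside its block after gluing. *)
Definition bstrong_fails B cent p C := exists f h : pt B -> R,
  [/\ forall x, 0 <= f x, forall x, 0 <= h x,
      forall x, h x = 0 \/ exists y s, [/\ 0 < s, kappa * s <= 1,
        relevant cent x y s & h x * mass (bball y (kappa * s))
           <= \sum_(z | bball y s z) wt z * f z] &
      C * (\sum_x wt x * f x `^ p) < \sum_x wt x * h x `^ p].

Definition bweak_fails B cent p C := exists (f : pt B -> R) lam (A : pred (pt B)),
  [/\ forall x, 0 <= f x, 0 < lam,
      forall x, A x -> exists y s, [/\ 0 < s, kappa * s <= 1,
        relevant cent x y s & lam * mass (bball y (kappa * s))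
           < \sum_(z | bball y s z) wt z * f z] &
      C * (\sum_x wt x * f x `^ p) < lam `^ p * \sum_(x | A x) wt x].

Lemma wt_ge0 B (x : pt B) : 0 <= wt x. Proof. by rewrite ltW// wt_gt0. Qed.

Lemma mass_ge0 B (A : pred (pt B)) : 0 <= mass A.
Proof. by apply: sumr_ge0 => i _; exact: wt_ge0. Qed.

Lemma le_mass B (A A' : pred (pt B)) : (forall z, A z -> A' z) -> mass A <= mass A'.
Proof.
move=> AA'; rewrite /mass [leRHS](bigID A)/=.
rewrite (eq_bigl (fun z => A' z && A z)); last first.
  by move=> z; apply/idP/andP => [Az|[]//]; split=> //; exact: AA'.
by rewrite lerDl sumr_ge0// => i _; exact: wt_ge0.
Qed.

Lemma wt_le_mass B (A : pred (pt B)) x : A x -> wt x <= mass A.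
Proof.
by move=> Ax; rewrite /mass (bigD1 x)//= lerDl sumr_ge0// => i _; exact: wt_ge0.
Qed.

Lemma bball_center B (y : pt B) s : 0 < s -> bball y s y.
Proof. by move=> s0; rewrite /bball dist_refl. Qed.

Lemma bball_dilate B (y z : pt B) s : 0 < s -> bball y s z -> bball y (kappa * s) z.
Proof.
by rewrite /bball => s0 /lt_le_trans; apply; rewrite ler_peMl// ltW.
Qed.

Lemma relevant_bball B cent (x y : pt B) s : 0 < s -> relevant cent x y s ->
  bball y s x.
Proof. by case: cent => //= s0 /eqP ->; exact: bball_center. Qed.

(** Chebyshev's inequality. *)
Lemma bstrong_bweak B cent p C : 1 <= p -> bstrong B cent p C -> bweak B cent p C.
Proof.
move=> p1 H f f0; have [h [h0 hM hC]] := H f f0; exists h; split => // lam lam0.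
apply: le_trans hC; rewrite mulr_sumr [leRHS](bigID (fun x => lam < h x))/=.
apply: (@le_trans _ _ (\sum_(i | lam < h i) wt i * h i `^ p)); last first.
  by rewrite lerDl sumr_ge0// => i _; rewrite mulr_ge0 ?wt_ge0 ?powR_ge0.
apply: ler_sum => i li; rewrite mulrC ler_wpM2l ?wt_ge0//.
by rewrite ge0_ler_powR ?nnegrE// ?ltW// (lt_le_trans ltr01).
Qed.

Lemma le_bstrong B cent p C C' : C <= C' -> bstrong B cent p C -> bstrong B cent p C'.
Proof.
move=> CC' H f f0; have [h [h0 hM hC]] := H f f0; exists h; split => //.
apply: (le_trans hC); rewrite ler_wpM2r//.
by apply: sumr_ge0 => i _; rewrite mulr_ge0 ?wt_ge0 ?powR_ge0.
Qed.

Lemma le_bweak B cent p C C' : C <= C' -> bweak B cent p C -> bweak B cent p C'.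
Proof.
move=> CC' H f f0; have [h [h0 hM hC]] := H f f0; exists h; split => // lam l0.
apply: (le_trans (hC lam l0)); rewrite ler_wpM2r//.
by apply: sumr_ge0 => i _; rewrite mulr_ge0 ?wt_ge0 ?powR_ge0.
Qed.

(* [K x z] bounds the reciprocal masses of the balls relevant to [x] and
   containing [z], except for the interactions [E x z] at points [x] of [L],
   where only the trivial bound by [1 / wt x] is available. *)
Definition avg_kernel B cent (L : pred (pt B)) (E : pt B -> pred (pt B))
    (K : pt B -> pt B -> R) C0 :=
  [/\ forall x z, 0 <= K x z, forall z, \sum_x wt x * K x z <= C0 &
      forall x y s z, 0 < s -> relevant cent x y s -> bball y s z ->
        ~~ (L x && E x z) -> 1 <= K x z * mass (bball y (kappa * s))].

(** * Type bounds from a kernel with bounded column sums *)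

Section kernel_bounds.
Context {B cent} {L : pred (pt B)} {E : pt B -> pred (pt B)}
  {K : pt B -> pt B -> R} {C0 : R} (KP : avg_kernel B cent L E K C0).
Variables (p : R) (f : pt B -> R).
Hypotheses (p1 : 1 <= p) (f0 : forall x, 0 <= f x).

Let p0 : 0 < p. Proof. exact: lt_le_trans p1. Qed.

Local Notation N := (\sum_x wt x * f x `^ p).

Let N0 : 0 <= N.
Proof. by apply: sumr_ge0 => i _; rewrite mulr_ge0 ?wt_ge0 ?powR_ge0. Qed.

Let h1 x := 2 * (\sum_z K x z * (wt z * f z `^ p)) `^ p^-1.

Let h2 x := if L x then (\sum_(z | E x z) wt z * f z) / wt x else 0.

Let S0 x : 0 <= \sum_z K x z * (wt z * f z `^ p).
Proof.
have [K0 _ _] := KP.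
by apply: sumr_ge0 => i _; rewrite !mulr_ge0 ?wt_ge0 ?powR_ge0.
Qed.

Let h10 x : 0 <= h1 x. Proof. by rewrite mulr_ge0 ?powR_ge0. Qed.

Let h20 x : 0 <= h2 x.
Proof.
rewrite /h2; case: ifP => // _; rewrite divr_ge0 ?wt_ge0// sumr_ge0// => i _.
by rewrite mulr_ge0 ?wt_ge0.
Qed.

(** On the regular pairs Jensen's inequality applies with weights [wt z / M], and [1 / M <= K x z];
    on the exceptional pairs [M >= wt x] suffices. *)
Let h12_majorant : majorant B cent f (fun x => h1 x + h2 x).
Proof.
have [K0 _ K1] := KP.
move=> x y s s0 rxy.
set M := mass _.
have Mx : wt x <= M by apply/wt_le_mass/bball_dilate => //; exact: relevant_bball rxy.
have M0 : 0 < M by apply: lt_le_trans Mx; exact: wt_gt0.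
rewrite (bigID (fun z => L x && E x z))/= addrC mulrDl lerD//.
  pose P z := bball y s z && ~~ (L x && E x z).
  have -> : \sum_(z | bball y s z && ~~ (L x && E x z)) wt z * f z = M * \sum_(z | P z) (wt z / M) * f z.
    rewrite mulr_sumr; apply: eq_bigr => z _.
    by rewrite mulrA [M * _]mulrC divfK// gt_eqF.
  rewrite mulrC ler_wpM2r ?(ltW M0)//.
  apply: le_trans (@wmean_le R _ P _ f p p1 _ f0 _) _.
  - by move=> z _; rewrite divr_ge0 ?wt_ge0// ltW.
  - rewrite -mulr_suml ler_pdivrMr// mul1r /M; apply: le_mass => z /andP[zb _].
    exact: bball_dilate.
  rewrite ler_wpM2l// ge0_ler_powR ?nnegrE ?invr_ge0 ?(ltW p0)//.
    by apply: sumr_ge0 => z _; rewrite !mulr_ge0 ?invr_ge0 ?wt_ge0 ?powR_ge0// ltW.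
  rewrite [leRHS](bigID P)/= -[leLHS]addr0 lerD//; last first.
    by apply: sumr_ge0 => z _; rewrite !mulr_ge0 ?wt_ge0 ?powR_ge0.
  apply: ler_sum => z /andP[zb zE].
  rewrite mulrAC mulrC ler_wpM2r ?mulr_ge0 ?wt_ge0 ?powR_ge0//.
  by rewrite -[leLHS]mul1r ler_pdivrMr//; exact: K1 zE.
rewrite /h2; case: ifPn => Lx /=; last by rewrite big_pred0 ?mul0r// => z; rewrite andbF.
apply: (@le_trans _ _ (\sum_(z | E x z) wt z * f z)).
  rewrite [leRHS](bigID (bball y s))/= -[leLHS]addr0 lerD//.
    by rewrite (eq_bigl (fun i => E x i && bball y s i))// => i; rewrite andbC.
  by apply: sumr_ge0 => z _; rewrite mulr_ge0 ?wt_ge0.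
rewrite mulrAC ler_pdivlMr ?wt_gt0// ler_wpM2l//.
by apply: sumr_ge0 => z _; rewrite mulr_ge0 ?wt_ge0.
Qed.

(** Exchanging the sums leaves the column sums of [K]. *)
Let sum_h1 : \sum_x wt x * h1 x `^ p <= 2 `^ p * C0 * N.
Proof.
have [K0 KC _] := KP.
have -> : \sum_x wt x * h1 x `^ p =
    2 `^ p * \sum_z (\sum_x wt x * K x z) * (wt z * f z `^ p).
  transitivity (\sum_x 2 `^ p * (\sum_z wt x * (K x z * (wt z * f z `^ p)))).
    apply: eq_bigr => x _.
    rewrite /h1 powRM ?powR_ge0// powRVK ?gt_eqF// mulrCA; congr (_ * _).
    by rewrite mulr_sumr.
  rewrite -mulr_sumr exchange_big/=; congr (_ * _); apply: eq_bigr => z _.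
  by rewrite mulr_suml; apply: eq_bigr => x _; rewrite !mulrA.
rewrite -mulrA ler_wpM2l ?powR_ge0// mulr_sumr; apply: ler_sum => z _.
by rewrite ler_wpM2r ?mulr_ge0 ?wt_ge0 ?powR_ge0.
Qed.

(** Hölder's inequality on [E x] up to the factor [2 ^ p], from Jensen's inequality with normalized
    weights. *)
Let sum_E_le x : (\sum_(z | E x z) wt z * f z) `^ p
  <= 2 `^ p * mass (E x) `^ (p - 1) * N.
Proof.
have := mass_ge0 B (E x); rewrite le_eqVlt => /orP[/eqP e0|e0].
  rewrite big1 ?powR0 ?gt_eqF// ?mulr_ge0 ?powR_ge0// => z Ez.
  by have := wt_le_mass B (E x) z Ez; rewrite -e0 leNgt wt_gt0.
set e := mass (E x).
have -> : \sum_(z | E x z) wt z * f z = e * \sum_(z | E x z) (wt z / e) * f z.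
  rewrite mulr_sumr; apply: eq_bigr => z _.
  by rewrite mulrA [e * _]mulrC divfK// gt_eqF.
rewrite powRM ?(ltW e0)//; last first.
  by apply: sumr_ge0 => z _; rewrite !mulr_ge0 ?invr_ge0 ?wt_ge0 ?(ltW e0).
rewrite -(mulr_powRB1 (ltW e0) p0).
apply: (@le_trans _ _ (e * e `^ (p - 1) * (2 `^ p * \sum_(z | E x z) wt z / e * f z `^ p))).
  rewrite ler_wpM2l ?mulr_ge0 ?powR_ge0 ?(ltW e0)//; apply: wmean_powR_le => //.
    by move=> z _; rewrite divr_ge0 ?wt_ge0 ?(ltW e0).
  by rewrite -mulr_suml mulfV ?gt_eqF.
have -> : \sum_(z | E x z) wt z / e * f z `^ p = e^-1 * \sum_(z | E x z) wt z * f z `^ p.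
  by rewrite mulr_sumr; apply: eq_bigr => z _; rewrite mulrAC mulrC.
set S := \sum_(z | _) _.
have -> : e * e `^ (p - 1) * (2 `^ p * (e^-1 * S)) = 2 `^ p * e `^ (p - 1) * S.
  by field; rewrite gt_eqF.
rewrite ler_wpM2l ?mulr_ge0 ?powR_ge0// [leRHS](bigID (E x))/= lerDl sumr_ge0// => z _.
by rewrite mulr_ge0 ?wt_ge0 ?powR_ge0.
Qed.

Lemma kernel_strong C1 :
  \sum_(x | L x) wt x * (mass (E x) `^ (p - 1) / wt x `^ p) <= C1 ->
  exists h : pt B -> R, [/\ forall x, 0 <= h x, majorant B cent f h &
    \sum_x wt x * h x `^ p <= 2 `^ p * (2 `^ p * C0 + 2 `^ p * C1) * N].
Proof.
move=> C1P; exists (fun x => h1 x + h2 x); split => //.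
  by move=> x; rewrite addr_ge0.
apply: (@le_trans _ _ (2 `^ p * (\sum_x wt x * h1 x `^ p + \sum_x wt x * h2 x `^ p))).
  rewrite -big_split/= mulr_sumr; apply: ler_sum => x _.
  by rewrite -mulrDr mulrCA ler_wpM2l ?wt_ge0// powR_addl_le.
rewrite -mulrA ler_wpM2l ?powR_ge0// mulrDl lerD//.
rewrite (bigID L)/= [X in _ + X]big1 ?addr0; last first.
  by move=> x /negPf; rewrite /h2 => ->; rewrite powR0 ?mulr0 ?gt_eqF.
set NN := N; have NN0 : 0 <= NN by exact: N0.
apply: (@le_trans _ _ (2 `^ p * (\sum_(x | L x) wt x * (mass (E x) `^ (p - 1) / wt x `^ p)) * NN));
  last first.
  by rewrite ler_wpM2r// ler_wpM2l ?powR_ge0.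
rewrite mulr_sumr mulr_suml; apply: ler_sum => x Lx; rewrite /h2 Lx.
rewrite powRM ?invr_ge0 ?wt_ge0//; last first.
  by apply: sumr_ge0 => z _; rewrite mulr_ge0 ?wt_ge0.
have wp : 0 < wt x `^ p by rewrite powR_gt0// wt_gt0.
have -> : (wt x)^-1 `^ p = (wt x `^ p)^-1.
  by rewrite -powR_inv1 ?wt_ge0// -powRrM mulN1r powRN.
have -> : 2 `^ p * (wt x * (mass (E x) `^ (p - 1) / wt x `^ p)) * NN =
    wt x * ((2 `^ p * mass (E x) `^ (p - 1) * NN) / wt x `^ p) by ring.
by rewrite ler_wpM2l ?wt_ge0// ler_wpM2r ?invr_ge0 ?(ltW wp).
Qed.

(** The level set of [h1 + h2] is covered by those of the summands at height [lam / 2]. Chebyshev's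
    inequality handles [h1]; a large [h2 x] forces [wt x] to be small, and the light points of [L]
    have controlled mass. *)
Lemma kernel_weak C1 C2 : 0 <= C1 -> 0 <= C2 ->
  (forall x, L x -> mass (E x) `^ (p - 1) <= C2) ->
  (forall t, 0 < t -> \sum_(x | L x && (wt x < t)) wt x <= C1 * t `^ p) ->
  exists h : pt B -> R, [/\ forall x, 0 <= h x, majorant B cent f h &
    forall lam, 0 < lam -> lam `^ p * \sum_(x | lam < h x) wt x
                           <= 2 `^ p * (2 `^ p * C0 + C1 * (2 `^ p * C2)) * N].
Proof.
move=> C10 C20 EC2 C1P; exists (fun x => h1 x + h2 x); split => //.
  by move=> x; rewrite addr_ge0.
move=> lam lam0.
have l20 : 0 < lam / 2 by rewrite divr_gt0.
have -> : lam `^ p = 2 `^ p * (lam / 2) `^ p.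
  by rewrite -powRM ?(ltW l20)// mulrC divfK.
rewrite -!mulrA ler_wpM2l ?powR_ge0// mulrDl.
apply: (@le_trans _ _ ((lam / 2) `^ p * (\sum_(x | lam / 2 < h1 x) wt x +
                                         \sum_(x | lam / 2 < h2 x) wt x))).
  rewrite ler_wpM2l ?powR_ge0//.
  have sumU (P Q S : pred (pt B)) : (forall x, P x -> Q x || S x) ->
      \sum_(x | P x) wt x <= \sum_(x | Q x) wt x + \sum_(x | S x) wt x.
    move=> PQS; rewrite [leLHS]big_mkcond [X in _ <= X + _]big_mkcond.
    rewrite [X in _ <= _ + X]big_mkcond -big_split/=; apply: ler_sum => x _.
    have := PQS x; have := wt_ge0 B x.
    case: (P x) => [w0 /(_ isT)|w0 _].
      by case: (Q x) => /=; case: (S x) => //= _; rewrite ?lerDl ?addr0 ?add0r.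
    by case: (Q x); case: (S x); rewrite ?addr_ge0.
  apply: sumU => x lx; have [//|h1l] := ltP (lam / 2) (h1 x).
  rewrite ltNge; apply/negP => h2l.
  have := lerD h1l h2l; rewrite -splitr => /le_lt_trans/(_ lx).
  by rewrite ltxx.
rewrite mulrDr lerD//.
  apply: le_trans sum_h1.
  rewrite mulr_sumr [leRHS](bigID (fun x => lam / 2 < h1 x))/= -[leLHS]addr0 lerD//.
    apply: ler_sum => x lx; rewrite mulrC ler_wpM2l ?wt_ge0//.
    by rewrite ge0_ler_powR ?nnegrE ?(ltW p0) ?(ltW l20) ?(ltW lx).
  by apply: sumr_ge0 => x _; rewrite mulr_ge0 ?wt_ge0 ?powR_ge0.
set D := 2 `^ p * C2 * N.
have D0 : 0 <= D by rewrite !mulr_ge0 ?powR_ge0.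
(* For [x] in [L], Hölder's inequality gives [h2 x <= D ^ (1 / p) / wt x], so [h2 x > lam / 2]
   implies [wt x < t]. *)
set t := D `^ p^-1 / (lam / 2).
have ht x : lam / 2 < h2 x -> L x && (wt x < t).
  rewrite /h2; case: ifPn => Lx lx; last first.
    by move: lx; rewrite ltNge (ltW l20).
  rewrite /= ltr_pdivlMr// mulrC -ltr_pdivlMr ?wt_gt0//.
  apply: (lt_le_trans lx); rewrite ler_wpM2r ?invr_ge0 ?wt_ge0//.
  set s := \sum_(z | _) _.
  have s0 : 0 <= s by apply: sumr_ge0 => z _; rewrite mulr_ge0 ?wt_ge0.
  rewrite -(@powRK _ s p) ?gt_eqF// ge0_ler_powR ?nnegrE ?invr_ge0 ?powR_ge0 ?(ltW p0)//.
  by apply: (le_trans (sum_E_le x)); rewrite ler_wpM2r// ler_wpM2l ?powR_ge0 ?EC2.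
have [t0|t0] := leP t 0.
  rewrite big_pred0 ?mulr0 ?mulr_ge0 ?powR_ge0// => x; apply/negbTE/negP => /ht.
  by move=> /andP[_ /lt_le_trans/(_ t0)]; rewrite ltNge wt_ge0.
apply: (@le_trans _ _ ((lam / 2) `^ p * (C1 * t `^ p))).
  rewrite ler_wpM2l ?powR_ge0//; apply: le_trans (C1P t t0).
  rewrite big_mkcond [leRHS]big_mkcond; apply: ler_sum => x _.
  case: ifPn => [/ht->//|_]; case: ifP => // _; exact: wt_ge0.
have lp : (lam / 2) `^ p != 0 by rewrite gt_eqF// powR_gt0.
rewrite /t powRM ?powR_ge0 ?invr_ge0 ?(ltW l20)// powRVK ?gt_eqF//.
rewrite -[_^-1 in X in _ * X <= _]powR_inv1 ?(ltW l20)// -powRrM mulN1r powRN.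
have -> : (lam / 2) `^ p * (C1 * (D / (lam / 2) `^ p)) = C1 * D by field.
by rewrite /D !mulrA.
Qed.

End kernel_bounds.
End block_operators.

(** * Families of blocks *)

Section families.
Context {R : realType} (kappa : R) (kappa_ge1 : 1 <= kappa).
Implicit Types (B : block R) (cent : bool) (p C : R).

Lemma powR_inv x p : 0 <= x -> x^-1 `^ p = (x `^ p)^-1 :> R.
Proof. by move=> x0; rewrite -(powR_inv1 x0) -powRrM mulN1r powRN. Qed.

Lemma mul_powRN x p : 0 < x -> x * (x `^ p)^-1 = x `^ (1 - p) :> R.
Proof. by move=> x0; rewrite powRB ?powRr1 ?ltW// (gt_eqF x0) implybT. Qed.

(** A ball centred at [x] contains [x], so the centred operator is the smaller one. *)
Lemma kernel_centered B cent L E K C0 :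
  avg_kernel kappa B false L E K C0 -> avg_kernel kappa B cent L E K C0.
Proof.
case: cent => //= -[K0 KC K1]; split => // x y s z s0 /eqP -> zb zE.
by apply: (K1 x) => //=; rewrite dist_refl.
Qed.

(** When [wt o = 1], the Dirac function of [o] then has maximal function at least [1 / (4 * wt x)]
    at each [x] in [L]. *)
Definition reaches B cent (o : pt B) (L : pred (pt B)) := forall x, L x ->
  exists y s, [/\ 0 < s, kappa * s <= 1, relevant cent x y s, bball y s o &
    mass (bball y (kappa * s)) <= 4 * wt x].

Lemma sum_delta B (o : pt B) (A : pred (pt B)) : A o ->
  \sum_(x | A x) wt x * (x == o)%:R = wt o :> R.
Proof.
move=> Ao; rewrite (bigD1 o)//= eqxx mulr1 big1 ?addr0// => x /andP[_ /negPf->].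
by rewrite mulr0.
Qed.

Lemma sum_delta_powR B (o : pt B) p : 1 <= p ->
  \sum_x wt x * (x == o)%:R `^ p = wt o :> R.
Proof.
move=> p1; rewrite -[RHS](@sum_delta B o xpredT)//; apply: eq_bigr => x _.
case: (x == o); first by rewrite powR1.
by rewrite powR0// gt_eqF// (lt_le_trans ltr01).
Qed.

Lemma reaches_strong_fails B cent o L p C : 1 <= p -> wt o = 1 ->
  reaches B cent o L -> C * 4 `^ p < \sum_(x | L x) wt x `^ (1 - p) ->
  bstrong_fails kappa B cent p C.
Proof.
move=> p1 o1 H CL.
exists (fun x => (x == o)%:R), (fun x => if L x then (4 * wt x)^-1 else 0); split.
- by move=> x.
- by move=> x; case: ifP => // _; rewrite invr_ge0 mulr_ge0 ?wt_ge0.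
- move=> x; case: ifPn => [Lx|_]; [right|by left].
  have [y [s [s0 ks xy yo ym]]] := H x Lx; exists y, s; split => //.
  rewrite sum_delta// o1 mulrC ler_pdivrMr ?mul1r// mulr_gt0 ?wt_gt0//.
rewrite sum_delta_powR// o1 mulr1 -(ltr_pM2r (_ : 0 < 4 `^ p)) ?powR_gt0//.
apply: (lt_le_trans CL); rewrite mulr_suml big_mkcond; apply: ler_sum => x _.
case: ifPn => [Lx|_]; last by rewrite !mulr_ge0 ?wt_ge0 ?powR_ge0.
rewrite powR_inv ?mulr_ge0 ?wt_ge0// powRM ?wt_ge0// -mul_powRN ?wt_gt0//.
rewrite le_eqVlt; apply/orP; left; apply/eqP.
by field; rewrite !gt_eqF ?powR_gt0 ?wt_gt0.
Qed.

(** The Dirac function of [o] is tested at height [1 / (8 * t)]: where [wt x <= t] its maximal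
    function is at least [1 / (4 * t)], and the extra factor 2 makes the inequality strict. *)
Lemma reaches_weak_fails B cent o L p t C : 1 <= p -> wt o = 1 -> 0 < t ->
  reaches B cent o L ->
  C * 8 `^ p * t `^ p < \sum_(x | L x && (wt x <= t)) wt x ->
  bweak_fails kappa B cent p C.
Proof.
move=> p1 o1 t0 H CL.
exists (fun x => (x == o)%:R), (8 * t)^-1, (fun x => L x && (wt x <= t)); split.
- by move=> x.
- by rewrite invr_gt0 mulr_gt0.
- move=> x /andP[Lx xt]; have [y [s [s0 ks xy yo ym]]] := H x Lx.
  exists y, s; split => //; rewrite sum_delta// o1 mulrC ltr_pdivrMr ?mulr_gt0// mul1r.
  apply: (le_lt_trans ym); rewrite -subr_gt0.
  by have : 0 < 4 * t + 4 * (t - wt x); [lra|have := wt_gt0 x; lra].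
rewrite sum_delta_powR// o1 mulr1 powR_inv ?mulr_ge0 ?(ltW t0)//.
by rewrite mulrC ltr_pdivlMr ?powR_gt0 ?mulr_gt0// powRM ?(ltW t0)// mulrA.
Qed.

(** One constant for all blocks in the positive cases, a bad block for every constant in the
    negative ones. The exponent [+oo] is left out, both operators being always bounded there. *)
Definition family_spec (Bk : nat -> block R) cent (Qs Qw : set (\bar R)) :=
  forall p, 1 <= p ->
  [/\ Qs p%:E -> exists C, forall n, bstrong kappa (Bk n) cent p C,
      ~ Qs p%:E -> forall C, exists n, bstrong_fails kappa (Bk n) cent p C,
      Qw p%:E -> exists C, forall n, bweak kappa (Bk n) cent p C &
      ~ Qw p%:E -> forall C, exists n, bweak_fails kappa (Bk n) cent p C].

Definition interleave (F0 F1 F2 : nat -> block R) (n : nat) : block R :=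
  if (n %% 3 == 0)%N then F0 (n %/ 3)%N
  else if (n %% 3 == 1)%N then F1 (n %/ 3)%N else F2 (n %/ 3)%N.

Lemma interleaveE F0 F1 F2 n : [/\ interleave F0 F1 F2 (n * 3) = F0 n,
  interleave F0 F1 F2 (n * 3 + 1) = F1 n & interleave F0 F1 F2 (n * 3 + 2) = F2 n].
Proof.
by split; rewrite /interleave ?modnMl ?mulnK// modnMDl divnMDl// addn0.
Qed.

Lemma interleave_ind F0 F1 F2 (P : block R -> Prop) :
  (forall n, P (F0 n)) -> (forall n, P (F1 n)) -> (forall n, P (F2 n)) ->
  forall n, P (interleave F0 F1 F2 n).
Proof. by move=> P0 P1 P2 n; rewrite /interleave; do 2?case: ifP => _. Qed.

(** The largest of three uniform constants serves all blocks, and failure along one subfamily is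
    failure of the whole. *)
Lemma family_spec_interleave F0 F1 F2 cent Qs0 Qw0 Qs1 Qw1 Qs2 Qw2 :
  family_spec F0 cent Qs0 Qw0 -> family_spec F1 cent Qs1 Qw1 ->
  family_spec F2 cent Qs2 Qw2 ->
  family_spec (interleave F0 F1 F2) cent (Qs0 `&` Qs1 `&` Qs2) (Qw0 `&` Qw1 `&` Qw2).
Proof.
move=> H0 H1 H2 p p1.
have [a0 b0 c0 d0] := H0 p p1; have [a1 b1 c1 d1] := H1 p p1.
have [a2 b2 c2 d2] := H2 p p1.
have max3 (C0 C1 C2 : R) (C := Num.max C0 (Num.max C1 C2)) :
  [/\ C0 <= C, C1 <= C & C2 <= C].
  by rewrite /C !le_max !lexx !orbT.
have ex3 (P : block R -> Prop) : (exists n, P (F0 n)) \/ (exists n, P (F1 n)) \/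
    (exists n, P (F2 n)) -> exists n, P (interleave F0 F1 F2 n).
  by move=> [[n Pn]|[[n Pn]|[n Pn]]];
    [exists (n * 3)%N|exists (n * 3 + 1)%N|exists (n * 3 + 2)%N];
    have [e0 e1 e2] := interleaveE F0 F1 F2 n; rewrite ?e0 ?e1 ?e2.
have not3 (P Q S : Prop) : ~ ((P /\ Q) /\ S) -> ~ P \/ ~ Q \/ ~ S.
  move=> H; have [hP|?] := pselect P; last by left.
  have [hQ|?] := pselect Q; last by right; left.
  by right; right => hS; apply: H.
split.
- move=> [[/a0[C0 h0] /a1[C1 h1]] /a2[C2 h2]].
  have [l0 l1 l2] := max3 C0 C1 C2.
  exists (Num.max C0 (Num.max C1 C2)).
  apply: (interleave_ind F0 F1 F2 (fun B => bstrong kappa B cent p _)) => n.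
  + exact: le_bstrong (h0 n).
  + exact: le_bstrong (h1 n).
  + exact: le_bstrong (h2 n).
- move=> /not3 nQ C; apply: (ex3 (fun B => bstrong_fails kappa B cent p C)).
  by move: nQ => [/b0|[/b1|/b2]] /(_ C); [left|right; left|right; right].
- move=> [[/c0[C0 h0] /c1[C1 h1]] /c2[C2 h2]].
  have [l0 l1 l2] := max3 C0 C1 C2.
  exists (Num.max C0 (Num.max C1 C2)).
  apply: (interleave_ind F0 F1 F2 (fun B => bweak kappa B cent p _)) => n.
  + exact: le_bweak (h0 n).
  + exact: le_bweak (h1 n).
  + exact: le_bweak (h2 n).
- move=> /not3 nQ C; apply: (ex3 (fun B => bweak_fails kappa B cent p C)).
  by move: nQ => [/d0|[/d1|/d2]] /(_ C); [left|right; left|right; right].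
Qed.

(** The conditions on the leaf masses alone to which both types reduce. In the weak failure [t] may
    itself be a leaf mass, whence [<=]. *)
Definition leaf_spec (L : nat -> finType) (w : forall n, L n -> R)
    (Qs Qw : set (\bar R)) := forall p, 1 <= p ->
  [/\ Qs p%:E -> exists C, forall n, \sum_l w n l `^ (1 - p) <= C,
      ~ Qs p%:E -> forall C, exists n, C < \sum_l w n l `^ (1 - p),
      Qw p%:E -> exists C, forall n t, 0 < t ->
        \sum_(l | w n l < t) w n l <= C * t `^ p &
      ~ Qw p%:E -> forall C, exists n t, 0 < t /\
        C * t `^ p < \sum_(l | w n l <= t) w n l].

Section leaves.
Variables (L : nat -> finType) (Bk : nat -> block R).
Variables (leaf : forall n, L n -> pt (Bk n)) (is_leaf : forall n, pred (pt (Bk n))).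
Hypothesis leaf_inj : forall n, injective (leaf n).
Hypothesis is_leafE : forall n x, is_leaf n x = (x \in codom (leaf n)).

Lemma sum_leaves n (P : pred (pt (Bk n))) (F : pt (Bk n) -> R) :
  \sum_(x | is_leaf n x && P x) F x = \sum_(l | P (leaf n l)) F (leaf n l).
Proof.
rewrite (eq_bigl (fun x => (x \in [set leaf n l | l in predT]%SET) && P x)); last first.
  move=> x; rewrite is_leafE; congr (_ && _).
  by apply/codomP/imsetP => [[l ->]|[l _ ->]]; exists l.
rewrite big_mkcondr/= big_imset/=; last by move=> i j _ _; exact: leaf_inj.
by rewrite [RHS]big_mkcond.
Qed.

Lemma sum_all_leaves n (F : pt (Bk n) -> R) :
  \sum_(x | is_leaf n x) F x = \sum_l F (leaf n l).
Proof. by rewrite -(sum_leaves n xpredT); apply: eq_bigl => x; rewrite andbT. Qed.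

(** Since the exceptional sets have bounded mass, the kernel bounds need only [leaf_spec]; testing
    on the Dirac function of [o] gives the failures. *)
Lemma family_spec_leaves (w : forall n, L n -> R) Qs Qw cent E K C0 :
  leaf_spec L w Qs Qw -> (forall n l, wt (leaf n l) = w n l) ->
  (forall n x, is_leaf n x -> mass (E n x) <= 2) ->
  (forall n, avg_kernel kappa (Bk n) cent (is_leaf n) (E n) (K n) C0) ->
  (forall n, exists2 o, wt o = 1 & reaches (Bk n) cent o (is_leaf n)) ->
  family_spec Bk cent Qs Qw.
Proof.
move=> spec wE E2 KP Rs p p1; have [a b c d] := spec p p1.
have p0 : 0 < p by exact: lt_le_trans p1.
have Ep n x : is_leaf n x -> mass (E n x) `^ (p - 1) <= 2 `^ (p - 1).
  by move=> lx; rewrite ge0_ler_powR ?nnegrE ?mass_ge0 ?subr_ge0// E2.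
split.
- move=> /a[C CP].
  exists (2 `^ p * (2 `^ p * C0 + 2 `^ p * (2 `^ (p - 1) * C))) => n f f0.
  apply: (kernel_strong kappa kappa_ge1 (KP n)) => //.
  apply: (@le_trans _ _ (\sum_(x | is_leaf n x) 2 `^ (p - 1) * wt x `^ (1 - p))).
    apply: ler_sum => x lx; rewrite -mul_powRN ?wt_gt0// mulrCA.
    by rewrite ler_wpM2r ?mulr_ge0 ?invr_ge0 ?powR_ge0 ?wt_ge0// Ep.
  rewrite -mulr_sumr; apply: ler_wpM2l; first exact: powR_ge0.
  by rewrite sum_all_leaves; under eq_bigr do rewrite wE; exact: CP.
- move=> /b H C; have [n Hn] := H (C * 4 `^ p); exists n.
  have [q q1 Rq] := Rs n; apply: (@reaches_strong_fails _ _ q (is_leaf n)) => //.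
  by rewrite sum_all_leaves; under eq_bigr do rewrite wE.
- move=> /c[C CP].
  exists (2 `^ p * (2 `^ p * C0 + C * (2 `^ p * 2 `^ (p - 1)))) => n f f0.
  apply: (@kernel_weak _ _ kappa_ge1 _ _ _ _ _ _ (KP n) p f p1 f0 C (2 `^ (p - 1))).
  + have := CP n 1 ltr01; rewrite powR1 mulr1; apply: le_trans.
    by apply: sumr_ge0 => l _; rewrite -wE wt_ge0.
  + exact: powR_ge0.
  + exact: Ep.
  + move=> t t0; rewrite (sum_leaves n (fun x => wt x < t)).
    by under eq_bigl do rewrite wE; under eq_bigr do rewrite wE; exact: CP.
- move=> /d H C; have [n [t [t0 Ht]]] := H (C * 8 `^ p); exists n.
  have [q q1 Rq] := Rs n; apply: (@reaches_weak_fails _ _ q (is_leaf n) p t) => //.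
  rewrite (sum_leaves n (fun x => wt x <= t)).
  by under eq_bigl do rewrite wE; under eq_bigr do rewrite wE.
Qed.

End leaves.

Lemma family_spec_all (Bk : nat -> block R) cent K C0 :
  (forall n, avg_kernel kappa (Bk n) cent pred0 (fun=> pred0) (K n) C0) ->
  family_spec Bk cent [set p | (1 <= p)%E] [set p | (1 <= p)%E].
Proof.
move=> KP p p1.
have H : exists C, forall n, bstrong kappa (Bk n) cent p C.
  exists (2 `^ p * (2 `^ p * C0 + 2 `^ p * 0)) => n f f0.
  apply: (kernel_strong kappa kappa_ge1 (KP n)) => //.
  by rewrite big_pred0.
split => [_|/=|_|/=].
- by [].
- by rewrite lee_fin p1.
- by have [C CP] := H; exists C => n; exact: bstrong_bweak.
- by rewrite lee_fin p1.
Qed.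

End families.

(** * Gluing a sequence of blocks *)

Definition glued (R : realType) (Bk : nat -> block R) := {n : nat & pt (Bk n)}.

Section glued_instances.
Context {R : realType} (Bk : nat -> block R).
HB.instance Definition _ := Choice.on (glued R Bk).
HB.instance Definition _ :=
  isPointed.Build (glued R Bk) (Tagged (fun n => pt (Bk n)) (origin (Bk 0))).
(** The discrete sigma-algebra is the Borel one, because every set is open ([grho_open]). *)
HB.instance Definition _ := @isMeasurable.Build default_measure_display
  (glued R Bk) discrete_measurable discrete_measurable0
  discrete_measurableC discrete_measurableU.
End glued_instances.

Section glued_metric.
Context {R : realType} (Bk : nat -> block R).
Local Notation X := (glued R Bk).

Definition gpt n (a : pt (Bk n)) : X := Tagged (fun n => pt (Bk n)) a.

Definition grho (x y : X) : R :=
  if tag x == tag y then dist (tagged x) (tagged_as x y) else 1.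

Lemma grho_in n (a b : pt (Bk n)) : grho (gpt n a) (gpt n b) = dist a b.
Proof. by rewrite /grho eqxx tagged_asE. Qed.

Lemma grho_out n m (a : pt (Bk n)) (b : pt (Bk m)) : n != m ->
  grho (gpt n a) (gpt m b) = 1.
Proof. by rewrite /grho => /negPf/= ->. Qed.

Lemma gdist_ge0 n (a b : pt (Bk n)) : 0 <= dist a b.
Proof.
by have [->|/dist_gt0/ltW//] := eqVneq a b; rewrite dist_refl.
Qed.

Lemma grho_metric : is_metric grho.
Proof.
split.
- move=> [n a] [m b]; have [e|/(grho_out _ _ a b) ->//] := eqVneq n m.
  by case: m / e b => b; rewrite grho_in gdist_ge0.
- move=> [n a] [m b]; have [e|nm] := eqVneq n m.
    case: m / e b => b; rewrite grho_in; split=> [d0|/eqP].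
      by have [->//|/dist_gt0] := eqVneq a b; rewrite d0 ltxx.
    by rewrite eq_Tagged/= => /eqP ->; rewrite dist_refl.
  rewrite (grho_out _ _ a b)//; split => [/eqP|[e _]]; first by rewrite oner_eq0.
  by move: nm; rewrite e eqxx.
- move=> [n a] [m b]; have [e|nm] := eqVneq n m.
    by case: m / e b => b; rewrite !grho_in dist_sym.
  by rewrite (grho_out _ _ a b)// (grho_out _ _ b a)// eq_sym.
- move=> [n a] [m b] [k c].
  have [e|nm] := eqVneq n m.
    case: m / e b => b; have [e|nk] := eqVneq n k.
      by case: k / e c => c; rewrite !grho_in dist_tri.
    by rewrite grho_in !grho_out// lerDr gdist_ge0.
  rewrite (grho_out _ _ a b)//; have [e|mk] := eqVneq m k.
    case: k / e c => c; rewrite grho_in grho_out// lerDl; exact: gdist_ge0.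
  rewrite (grho_out _ _ b c)//; have [e|nk] := eqVneq n k.
    (* A detour through another block has length 2, more than the diameter of a block. *)
    by case: k / e {mk} c => c; rewrite grho_in; have := dist_lt1 a c; lra.
  by rewrite grho_out//; lra.
Qed.

Lemma mball_local n (a : pt (Bk n)) s : s <= 1 ->
  mball grho (gpt n a) s = [set x | exists2 b, bball a s b & x = gpt n b].
Proof.
move=> s1; apply/seteqP; split=> [[m b]|_ [b ab ->]]; last first.
  by rewrite /mball/= grho_in.
rewrite /mball/=; have [e|nm] := eqVneq n m.
  by case: m / e b => b; rewrite grho_in; exists b.
by rewrite (grho_out _ _ a b)// ltNge s1.
Qed.

Lemma mball_global x s : 1 < s -> mball grho x s = setT.
Proof.
move=> s1; apply/seteqP; split=> // y _; rewrite /mball/=.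
case: x y => [n a] [m b]; apply: le_lt_trans s1; have [e|nm] := eqVneq n m.
  by case: m / e b => b; rewrite grho_in ltW// dist_lt1.
by rewrite (grho_out _ _ a b).
Qed.

(** In a finite block the ball whose radius is the least distance to another point, capped at 1, is
    a singleton. *)
Lemma grho_open (U : set X) : rho_open grho U.
Proof.
move=> [n a] Ua.
exists (\big[Num.min/1]_(b | b != a) dist a b).
  by rewrite lt_bigmin// => b ba; rewrite dist_gt0// eq_sym.
rewrite mball_local; last exact: bigmin_le_id.
move=> _ [b ab ->]; have [->//|ba] := eqVneq b a.
by move: ab; rewrite /bball ltNge bigmin_le_cond.
Qed.

End glued_metric.

(** * The measure of the glued space and its integrals *)

Section glued_measure.
Context {R : realType} (Bk : nat -> block R).
Local Notation X := (glued R Bk).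
Local Notation gpt := (gpt Bk).

(* Normalized so that block [n] has mass [2^-n]. *)
Definition gcoef n : R := 2^-1 ^+ n / mass (B := Bk n) xpredT.

Lemma gtotal_gt0 n : 0 < mass (B := Bk n) xpredT.
Proof. by apply: (lt_le_trans (wt_gt0 (origin (Bk n)))); exact: wt_le_mass. Qed.

Lemma gcoef_gt0 n : 0 < gcoef n.
Proof. by rewrite divr_gt0 ?gtotal_gt0// exprn_gt0. Qed.

Lemma gwt_ge0 n (a : pt (Bk n)) : 0 <= gcoef n * wt a.
Proof. by rewrite mulr_ge0 ?wt_ge0// ltW// gcoef_gt0. Qed.

(** A sum of point masses; [nth] serves to index the points by naturals, as [msum] demands. *)
Definition gblock_measure n : {measure set X -> \bar R} :=
  msum (fun k => mscale (NngNum (gwt_ge0 n (nth (origin (Bk n)) (enum (pt (Bk n))) k)))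
     (dirac (gpt n (nth (origin (Bk n)) (enum (pt (Bk n))) k)))) #|pt (Bk n)|.

Definition gmu : {measure set X -> \bar R} := mseries gblock_measure 0.

Local Open Scope ereal_scope.

Lemma gintE (g : X -> \bar R) : (forall x, 0 <= g x) ->
  \int[gmu]_x g x = \sum_(n <oo) \sum_(a : pt (Bk n)) (gcoef n * wt a)%:E * g (gpt n a).
Proof.
move=> g0; rewrite /gmu ge0_integral_measure_series//.
apply: eq_eseriesr => n _.
rewrite /gblock_measure ge0_integral_measure_sum//.
transitivity (\sum_(k < #|pt (Bk n)|)
   (gcoef n * wt (nth (origin (Bk n)) (enum (pt (Bk n))) k))%:E *
     g (gpt n (nth (origin (Bk n)) (enum (pt (Bk n))) k))).
  apply: eq_bigr => k _; rewrite ge0_integral_mscale//.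
  by rewrite integral_dirac// ?diracT ?mul1e//.
rewrite -(big_mkord xpredT (fun k =>
   (gcoef n * wt (nth (origin (Bk n)) (enum (pt (Bk n))) k))%:E *
     g (gpt n (nth (origin (Bk n)) (enum (pt (Bk n))) k)))).
by rewrite cardE -(big_nth _ xpredT (fun a => (gcoef n * wt a)%:E * g (gpt n a))) big_enum.
Qed.

Lemma gint_local n (g : X -> \bar R) : (forall x, 0 <= g x) ->
  (forall x, tag x != n -> g x = 0) ->
  \int[gmu]_x g x = \sum_(a : pt (Bk n)) (gcoef n * wt a)%:E * g (gpt n a).
Proof.
move=> g0 gn; rewrite gintE// (@nneseriesD1 R _ n xpredT)//; last first.
  by move=> k _; apply: sume_ge0 => a _; rewrite mule_ge0// lee_fin gwt_ge0.
rewrite eseries0 ?adde0// => k _ kn; rewrite big1// => a _.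
by rewrite gn ?mule0.
Qed.

(** Blockwise inequalities with a common constant add up. *)
Lemma gint_le (g g' : X -> \bar R) (C : R) : (0 <= C)%R ->
  (forall x, 0 <= g x) -> (forall x, 0 <= g' x) ->
  (forall n, \sum_(a : pt (Bk n)) (gcoef n * wt a)%:E * g (gpt n a) <=
     C%:E * \sum_(a : pt (Bk n)) (gcoef n * wt a)%:E * g' (gpt n a)) ->
  \int[gmu]_x g x <= C%:E * \int[gmu]_x g' x.
Proof.
move=> C0 g0 g'0 H; rewrite !gintE// -nneseriesZl//; last first.
  by move=> k _; apply: sume_ge0 => a _; rewrite mule_ge0// lee_fin gwt_ge0.
apply: lee_nneseries => [k _ _|k _]; last exact: H.
by apply: sume_ge0 => a _; rewrite mule_ge0// lee_fin gwt_ge0.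
Qed.

Lemma gmuE (A : set X) : gmu A = \int[gmu]_x (\1_A x)%:E.
Proof. by rewrite integral_indic// setIT. Qed.

Lemma gmu_setT : 0 < gmu setT < +oo.
Proof.
apply/andP; split.
  rewrite gmuE; apply: (@lt_le_trans _ _ (gcoef 0 * wt (origin (Bk 0)))%:E).
    by rewrite lte_fin mulr_gt0 ?gcoef_gt0 ?wt_gt0.
  rewrite gintE// (@nneseriesD1 R _ 0%N xpredT)//=; last first.
    by move=> k _; apply: sume_ge0 => a _; rewrite mule_ge0// lee_fin gwt_ge0.
  rewrite (bigD1 (origin (Bk 0)))//= indicT mule1 -addeA leeDl// adde_ge0//.
    by apply: sume_ge0 => a _; rewrite mule_ge0// lee_fin gwt_ge0.
  apply: nneseries_ge0 => k _ _; apply: sume_ge0 => a _.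
  by rewrite mule_ge0// lee_fin gwt_ge0.
rewrite gmuE gintE//.
rewrite (@eq_eseriesr _ _ (fun n => (2^-1 ^+ n)%:E)); last first.
  move=> n _; rewrite indicT; under eq_bigr do rewrite mule1.
  rewrite sumEFin -mulr_sumr /gcoef divfK// gt_eqF//; exact: gtotal_gt0.
rewrite (_ : (fun n => \sum_(0 <= k < n) (2^-1 ^+ k)%:E) =
   EFin \o series (geometric 1%R (2^-1 : R)%R)); last first.
  apply/funext => n; rewrite /= sumEFin; congr EFin.
  by apply: eq_bigr => k _; rewrite /geometric/= mul1r.
rewrite EFin_lim ?ltry//; apply: is_cvg_geometric_series.
by rewrite ger0_norm ?invr_ge0// invf_lt1// ltr1n.
Qed.

Definition gV : R := fine (gmu setT).

Lemma gVE : gmu setT = gV%:E.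
Proof. by rewrite /gV fineK// ge0_fin_numE; have /andP[] := gmu_setT. Qed.

Lemma gV_gt0 : (0 < gV)%R.
Proof. by rewrite -lte_fin -gVE; have /andP[] := gmu_setT. Qed.

Lemma gint_ball n (a : pt (Bk n)) s (f : X -> R) : (s <= 1)%R -> (forall x, 0 <= f x)%R ->
  \int[gmu]_(x in mball (grho Bk) (gpt n a) s) (f x)%:E =
  (gcoef n * \sum_(b | bball a s b) wt b * f (gpt n b))%:E.
Proof.
move=> s1 f0; rewrite integral_mkcond (gint_local n).
- rewrite mulr_sumr -sumEFin [RHS]big_mkcond; apply: eq_bigr => b _.
  rewrite patchE mball_local//; case: ifPn => [/set_mem[c ac /eqP]|].
    by rewrite eq_Tagged/= => /eqP ->; rewrite ac -EFinM mulrA.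
  case: ifPn => [ab|_ _]; last by rewrite mule0.
  by rewrite notin_setE => /(_ (ex_intro2 _ _ b ab erefl)).
- by move=> x; rewrite patchE; case: ifP; rewrite ?lee_fin.
- move=> x xn; rewrite patchE mball_local//; case: ifPn => // /set_mem[b _ xb].
  by move: xn; rewrite xb eqxx.
Qed.

Lemma gmu_ball n (a : pt (Bk n)) s : (s <= 1)%R ->
  gmu (mball (grho Bk) (gpt n a) s) = (gcoef n * mass (bball a s))%:E.
Proof.
move=> s1; have := @gint_ball n a s (cst 1%R) s1 (fun=> ler01).
rewrite -[gmu _]mul1e -integral_cst// => e; apply: (etrans e); congr (_ * _)%:E.
by apply: eq_bigr => b _; rewrite mulr1.
Qed.

Lemma gmetric_measure_space : metric_measure_space (grho Bk) gmu.
Proof.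
split.
- by exists point.
- exact: grho_metric.
- apply/seteqP; split => // U _; apply: sub_sigma_algebra; exact: grho_open.
- move=> [n a] s s0; have [s1|s1] := leP s 1%R; last by rewrite mball_global// gmu_setT.
  rewrite gmu_ball// ltry andbT lte_fin mulr_gt0 ?gcoef_gt0//.
  by apply: (lt_le_trans (wt_gt0 a)); apply: wt_le_mass; exact: bball_center.
Qed.

(** Both balls stay in the block, so the normalizing factor cancels. *)
Lemma gnot_doubling : (forall C : R, exists n (a : pt (Bk n)) s, [/\ 0 < s, 2 * s <= 1 &
    C * mass (bball a s) < mass (bball a (2 * s))])%R ->
  ~ doubling (grho Bk) gmu.
Proof.
move=> H [C CP]; have [n [a [s [s0 s1 Hs]]]] := H C.
have := CP (gpt n a) s s0; rewrite !gmu_ball//; last by lra.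
by rewrite lee_fin mulrCA ler_pM2l ?gcoef_gt0// leNgt Hs.
Qed.

End glued_measure.

(** * Transference of local bounds *)

Section transference.
Context {R : realType} (Bk : nat -> block R) (kappa : R) (kappa_ge1 : 1 <= kappa).
Local Notation X := (glued R Bk).
Local Notation gpt := (gpt Bk).
Local Notation mu := (gmu Bk).
Local Notation rho := (grho Bk).
Local Notation c := (gcoef Bk).
Implicit Types f : X -> R.

Definition gop (cent : bool) : (X -> R) -> X -> \bar R :=
  if cent then Mc rho mu kappa else Mnc rho mu kappa.

Lemma gop_ub cent f x (H : \bar R) :
  (forall y s, 0 < s -> (if cent then y = x else rho y x < s) ->
     (kavg rho mu kappa f y s <= H)%E) -> (gop cent f x <= H)%E.
Proof.
rewrite /gop; case: cent => yH; apply: ge_ereal_sup.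
  by move=> _ [s s0 <-]; exact: yH.
by move=> _ [[y s] /= [s0 yx] <-]; exact: yH.
Qed.

Lemma gop_lb cent f x y s : 0 < s -> (if cent then y = x else rho y x < s) ->
  (kavg rho mu kappa f y s <= gop cent f x)%E.
Proof.
rewrite /gop; case: cent => s0 yx; apply: ereal_sup_ubound => /=.
  by exists s => //; rewrite yx.
by exists (y, s).
Qed.

Lemma relevant_gpt cent n (a b : pt (Bk n)) s : relevant cent b a s ->
  if cent then gpt n a = gpt n b else rho (gpt n a) (gpt n b) < s.
Proof. by case: cent => /= [/eqP ->//|]; rewrite grho_in. Qed.

Lemma bball_large n (a : pt (Bk n)) s : 1 <= s -> bball a s =1 xpredT.
Proof. by move=> s1 b; rewrite /bball (lt_le_trans _ s1)// dist_lt1. Qed.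

(** Needed because [kappa * s] may exceed 1 when [s] does not; the dilated ball is then the whole
    space, which is at least as heavy as the block. *)
Lemma gmu_ball_ge n (a : pt (Bk n)) s :
  c n * mass (bball a s) <= fine (mu (mball rho (gpt n a) s)).
Proof.
have [s1|s1] := leP s 1; first by rewrite gmu_ball.
rewrite mball_global//; rewrite -lee_fin fineK; last by rewrite gVE.
have -> : mass (bball a s) = mass (bball a 1).
  by apply: eq_bigl => b; rewrite !bball_large// ltW.
by rewrite -gmu_ball// le_measure// inE.
Qed.

Lemma kavg_localE n (a : pt (Bk n)) s f : 0 < s -> kappa * s <= 1 ->
  kavg rho mu kappa f (gpt n a) s =
  ((\sum_(b | bball a s b) wt b * `|f (gpt n b)|) / mass (bball a (kappa * s)))%:E.
Proof.
move=> s0 ks; have s1 : s <= 1 by apply: le_trans ks; rewrite ler_peMl// ltW.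
rewrite /kavg gmu_ball// gint_ball// -EFinM; congr EFin.
rewrite [fine _]/= invfM mulrACA mulVf ?mul1r; first by rewrite mulrC.
by rewrite gt_eqF// gcoef_gt0.
Qed.

Lemma kavg_local_le n (a : pt (Bk n)) s f : 0 < s -> s <= 1 ->
  (kavg rho mu kappa f (gpt n a) s <=
  ((\sum_(b | bball a s b) wt b * `|f (gpt n b)|) / mass (bball a (kappa * s)))%:E)%E.
Proof.
move=> s0 s1; rewrite /kavg gint_ball// -EFinM lee_fin.
have M0 : 0 < mass (bball a (kappa * s)).
  apply: (lt_le_trans (wt_gt0 a)); apply: wt_le_mass; apply: bball_center.
  by rewrite mulr_gt0// (lt_le_trans ltr01).
have S0 : 0 <= \sum_(b | bball a s b) wt b * `|f (gpt n b)|.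
  by apply: sumr_ge0 => b _; rewrite mulr_ge0 ?wt_ge0.
have cM := gmu_ball_ge n a (kappa * s).
have cM0 : 0 < c n * mass (bball a (kappa * s)) by rewrite mulr_gt0 ?gcoef_gt0.
set S := \sum_(b | _) _ in S0 *; set M := mass _ in M0 cM cM0 *.
set F := fine _ in cM *; have F0 : 0 < F by exact: lt_le_trans cM.
rewrite -[F^-1 * _]mulrC ler_pdivrMr// -[S / M * F]mulrAC ler_pdivlMr//.
by rewrite -mulrA mulrCA ler_wpM2l.
Qed.

Lemma kavg_globalE y s f : 1 < s ->
  kavg rho mu kappa f y s = (((gV Bk)^-1)%:E * \int[mu]_x (`|f x|)%:E)%E.
Proof.
move=> s1; rewrite /kavg !mball_global//.
by rewrite (lt_le_trans s1)// ler_peMl// ltW// (lt_trans ltr01).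
Qed.

(** Balls of radius at most 1 stay in a block and are controlled by [h]; larger ones are the whole
    space and are controlled by [G]. *)
Lemma gop_le cent f (h : forall n, pt (Bk n) -> R) G :
  (forall n, majorant kappa (Bk n) cent (fun a => `|f (gpt n a)|) (h n)) ->
  (((gV Bk)^-1)%:E * \int[mu]_x (`|f x|)%:E <= G%:E)%E ->
  forall n a, (gop cent f (gpt n a) <= (Num.max (h n a) G)%:E)%E.
Proof.
move=> hM fG n b; apply: gop_ub => -[m a] s s0 rel.
have [s1|s1] := leP s 1; last first.
  by rewrite kavg_globalE// (le_trans fG)// lee_fin le_max lexx orbT.
(* A relevant ball of radius at most 1 is centred in the block of [b]; the equality [e] transports
   its centre there. *)
have [e rel'] : exists e : m = n, relevant cent b (ecast i (pt (Bk i)) e a) s.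
  move: rel; case: cent {hM} => [e|].
    have mn : m = n by exact: (congr1 tag e).
    by case: n / mn b e => b /eqP; rewrite eq_Tagged => ab; exists erefl.
  have [e|mn] := eqVneq m n.
    by move: e b => e; case: n / e => b; rewrite grho_in; exists erefl.
  by rewrite (grho_out Bk _ _ a b)// ltNge s1.
case: n / e b rel rel' => b _ /= rel'.
apply: (le_trans (kavg_local_le m a s f s0 s1)).
rewrite lee_fin ler_pdivrMr; last first.
  apply: (lt_le_trans (wt_gt0 a)); apply: wt_le_mass; apply: bball_center.
  by rewrite mulr_gt0// (lt_le_trans ltr01).
apply: (le_trans (hM m b a s s0 rel')); rewrite ler_wpM2r ?mass_ge0//.
by rewrite le_max lexx.
Qed.

Lemma gop_ge0 cent f x : (0 <= gop cent f x)%E.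
Proof.
apply: (@le_trans _ _ (kavg rho mu kappa f x 1)).
  apply: mule_ge0; first by rewrite lee_fin invr_ge0 fine_ge0.
  by apply: integral_ge0 => z _; rewrite lee_fin.
apply: gop_lb => //; case: cent => //.
by have [_ /(_ x x)[_ ->]//] := grho_metric Bk.
Qed.

Section finite_exponent.
Variables (p : R) (p1 : 1 <= p).

Let p0 : 0 < p. Proof. exact: lt_le_trans p1. Qed.

Lemma gint_powR f :
  (\int[mu]_x (`|(EFin \o f) x| `^ p) = \int[mu]_x (`|f x| `^ p)%:E)%E.
Proof. by apply: eq_integral => x _; rewrite -poweR_EFin. Qed.

Lemma gLnormE (g : X -> \bar R) : ('N[mu]_p%:E[g] = (\int[mu]_x (`|g x| `^ p)) `^ p^-1)%E.
Proof. by rewrite unlock. Qed.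

(** Jensen's inequality on a space of finite mass: [le_add_powR] is integrated with [t] the p-mean
    of [f]. *)
Lemma gmean_le f I : (\int[mu]_x (`|f x| `^ p)%:E = I%:E)%E -> exists G,
  [/\ 0 <= G, (((gV Bk)^-1)%:E * \int[mu]_x (`|f x|)%:E <= G%:E)%E &
      G `^ p * gV Bk <= 2 `^ p * I].
Proof.
move=> fI; have V0 := gV_gt0 Bk; set V := gV Bk in V0 *.
have I0 : 0 <= I.
  by rewrite -lee_fin -fI; apply: integral_ge0 => x _; rewrite lee_fin powR_ge0.
have Ht (t : R) : 0 < t ->
    (V^-1%:E * \int[mu]_x (`|f x|)%:E <= (t + t `^ (1 - p) * (I / V))%:E)%E.
  move=> t0.
  have : (\int[mu]_x (`|f x|)%:E <= (t * V + t `^ (1 - p) * I)%:E)%E.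
    rewrite EFinD !EFinM -gVE -fI -integral_cst//.
    rewrite -ge0_integralZl//; last by rewrite lee_fin powR_ge0.
    rewrite -ge0_integralD//; last by move=> x _; rewrite -EFinM lee_fin mulr_ge0 ?powR_ge0.
    - apply: ge0_le_integral => //.
      move=> x _; rewrite /= -EFinM -EFinD lee_fin; exact: le_add_powR.
    - by move=> x _ /=; rewrite lee_fin ltW.
  move=> H; have -> : t + t `^ (1 - p) * (I / V) = V^-1 * (t * V + t `^ (1 - p) * I).
    by field; rewrite gt_eqF.
  by rewrite EFinM lee_pmul2l// lte_fin invr_gt0.
(* If [I = 0], letting [t] tend to 0 shows that the average vanishes. *)
have [A0|An0] := eqVneq (I / V) 0.
  exists 0; split => //; last by rewrite powR0 ?gt_eqF// mul0r mulr_ge0 ?powR_ge0.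
  apply/lee_addgt0Pr => e e0; rewrite add0e.
  by have := Ht e e0; rewrite A0 mulr0 addr0.
have A0 : 0 < I / V by rewrite lt_def An0 divr_ge0// ltW.
set t := (I / V) `^ p^-1; have t0 : 0 < t by exact: powR_gt0.
have tp : t `^ p = I / V by rewrite powRVK ?gt_eqF// ltW.
exists (2 * t); split; first by rewrite mulr_ge0// ltW.
  apply: (le_trans (Ht t t0)); rewrite lee_fin -tp -powRD; last first.
    by rewrite subrK oner_eq0.
  by rewrite subrK powRr1 ?(ltW t0)// mulr2n mulrDl mul1r.
by rewrite powRM ?(ltW t0)// tp -mulrA divfK// gt_eqF.
Qed.

Lemma gfin_Lp f : in_Lp mu p%:E f ->
  exists2 I, (\int[mu]_x (`|f x| `^ p)%:E = I%:E)%E & 0 <= I.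
Proof.
move=> [_ fp]; have I0 : (0 <= \int[mu]_x (`|f x| `^ p)%:E)%E.
  by apply: integral_ge0 => x _; rewrite lee_fin powR_ge0.
have : (\int[mu]_x (`|f x| `^ p)%:E < +oo)%E.
  rewrite -gint_powR -poweR_Lnorm ?gt_eqF//; exact: poweR_lty.
case: (integral _ _ _) I0 => // r r0 _; exists r => //.
Qed.

(* The local contribution [Phi] together with the average over the whole
   space, which dominates all balls of radius greater than [1]. *)
Lemma gint_local_global f (Phi : X -> R) I G C :
  (\int[mu]_x (`|f x| `^ p)%:E = I%:E)%E ->
  0 <= C -> (forall x, 0 <= Phi x) -> 0 <= G -> G `^ p * gV Bk <= 2 `^ p * I ->
  (forall n, \sum_a wt a * Phi (gpt n a) <= C * \sum_a wt a * `|f (gpt n a)| `^ p) ->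
  (\int[mu]_x (Phi x + G `^ p)%:E <= ((C + 2 `^ p) * I)%:E)%E.
Proof.
move=> fI C0 Phi0 G0 GI H.
under eq_integral do rewrite EFinD.
rewrite ge0_integralD//=; last 2 first.
- by move=> x _; rewrite lee_fin.
- by move=> x _; rewrite lee_fin powR_ge0.
rewrite mulrDl EFinD leeD//; last by rewrite integral_cst// gVE -EFinM lee_fin.
rewrite EFinM -fI; apply: gint_le => //.
  move=> n; under eq_bigr do rewrite -EFinM -mulrA.
  under [in leRHS]eq_bigr do rewrite -EFinM -mulrA.
  rewrite !sumEFin -EFinM lee_fin -!mulr_sumr mulrCA ler_wpM2l//.
  by rewrite ltW// gcoef_gt0.
Qed.

Lemma local_majorants cent f (P : forall n, (pt (Bk n) -> R) -> Prop) :
  (forall n, exists h : pt (Bk n) -> R, [/\ forall x, 0 <= h x,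
     majorant kappa (Bk n) cent (fun a => `|f (gpt n a)|) h & P n h]) ->
  exists h : forall n, pt (Bk n) -> R, forall n, [/\ forall x, 0 <= h n x,
     majorant kappa (Bk n) cent (fun a => `|f (gpt n a)|) (h n) & P n (h n)].
Proof. by move=> H; exists (fun n => sval (cid (H n))) => n; case: cid. Qed.

(** The operator is at most [max (h, G)], whose p-th power is at most [h ^ p + G ^ p]. *)
Lemma glued_strong cent : (exists C, forall n, bstrong kappa (Bk n) cent p C) ->
  strong_type mu (gop cent) p%:E.
Proof.
move=> [C' CP']; pose C := Num.max C' 0.
have C0 : 0 <= C by rewrite le_max lexx orbT.
have CP n : bstrong kappa (Bk n) cent p C.
  by apply: le_bstrong (CP' n); rewrite le_max lexx.
exists ((C + 2 `^ p) `^ p^-1) => f fp; have [I fI I0] := gfin_Lp f fp.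
have [G [G0 fG GI]] := gmean_le f I fI.
have [h hP] := local_majorants cent f _ (fun n => CP n _ (fun x => normr_ge0 (f (gpt n x)))).
pose h' (x : X) := h (tag x) (tagged x).
have K0 : 0 <= C + 2 `^ p by rewrite addr_ge0// powR_ge0.
rewrite !gLnormE gint_powR fI poweR_EFin.
have -> : (((C + 2 `^ p) `^ p^-1)%:E * (I `^ p^-1)%:E = ((C + 2 `^ p) * I)%:E `^ p^-1)%E.
  by rewrite poweR_EFin powRM.
apply: gt0_ler_poweR; rewrite ?invr_ge0 ?(ltW p0)//.
- by rewrite in_itv/= leey andbT; apply: integral_ge0 => x _; exact: poweR_ge0.
- by rewrite in_itv/= leey andbT lee_fin mulr_ge0.
apply: le_trans (gint_local_global f (fun x => h' x `^ p) I G C fI C0 _ G0 GI _).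
- apply: ge0_le_integral => //.
    by move=> x _; exact: poweR_ge0.
  move=> [n a] _; rewrite gee0_abs ?gop_ge0//.
    apply: (@le_trans _ _ ((Num.max (h n a) G)%:E `^ p)%E).
      apply: gt0_ler_poweR; rewrite ?(ltW p0)//.
      * by rewrite in_itv/= leey gop_ge0.
      * by rewrite in_itv/= leey andbT lee_fin le_max G0 orbT.
      * by apply: gop_le => // m; have [] := hP m.
    rewrite poweR_EFin lee_fin /h'/=; case: (leP (h n a) G) => _.
      by rewrite lerDr powR_ge0.
    by rewrite lerDl powR_ge0.
- by move=> x; exact: powR_ge0.
- by move=> n; have [] := hP n.
Qed.

(** Where [max (h, G) > lam], either [h > lam] or [lam ^ p <= G ^ p]; the constant [G] is thus
    absorbed by its p-th power. *)
Lemma glued_weak cent : (exists C, forall n, bweak kappa (Bk n) cent p C) ->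
  weak_type mu (gop cent) p%:E.
Proof.
move=> [C' CP']; pose C := Num.max C' 0.
have C0 : 0 <= C by rewrite le_max lexx orbT.
have CP n : bweak kappa (Bk n) cent p C.
  by apply: le_bweak (CP' n); rewrite le_max lexx.
exists ((C + 2 `^ p) `^ p^-1) => f fp lam lam0; have [I fI I0] := gfin_Lp f fp.
have [G [G0 fG GI]] := gmean_le f I fI.
have [h hP] := local_majorants cent f _ (fun n => CP n _ (fun x => normr_ge0 (f (gpt n x)))).
pose h' (x : X) := h (tag x) (tagged x).
have K0 : 0 <= C + 2 `^ p by rewrite addr_ge0// powR_ge0.
rewrite gLnormE gint_powR fI poweR_EFin.
have -> : (((C + 2 `^ p) `^ p^-1)%:E * (I `^ p^-1)%:E = ((C + 2 `^ p) * I)%:E `^ p^-1)%E.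
  by rewrite poweR_EFin powRM.
rewrite -[X in (X%:E * _)%E](@powRK _ lam p) ?gt_eqF ?(ltW lam0)// -poweR_EFin.
rewrite -poweRM ?lee_fin ?powR_ge0//.
apply: gt0_ler_poweR; rewrite ?invr_ge0 ?(ltW p0)//.
- by rewrite in_itv/= leey andbT mule_ge0// lee_fin powR_ge0.
- by rewrite in_itv/= leey andbT lee_fin mulr_ge0.
apply: le_trans (gint_local_global f (fun x => lam `^ p * (lam < h' x)%R%:R) I G C fI C0 _ G0 GI _).
- rewrite gmuE -ge0_integralZl//; last by rewrite lee_fin powR_ge0.
  apply: ge0_le_integral => //.
    by move=> x _; rewrite mule_ge0// lee_fin powR_ge0.
  move=> [n a] _; rewrite -EFinM lee_fin indicE.
    case: (boolP (_ \in _)) => [/set_mem/= la|_]; last first.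
      by rewrite mulr0 addr_ge0 ?mulr_ge0 ?powR_ge0.
    have {la} : lam < Num.max (h n a) G.
      rewrite -lte_fin; by apply: (lt_le_trans la); apply: gop_le => // m; have [] := hP m.
    rewrite /h'/= lt_max => /orP[->|lG].
      by rewrite lerDl powR_ge0.
    rewrite mulr1 -[leLHS]add0r lerD ?mulr_ge0 ?powR_ge0//.
    by rewrite ge0_ler_powR ?nnegrE ?(ltW p0) ?(ltW lam0) ?(ltW lG).
- by move=> x; rewrite mulr_ge0 ?powR_ge0.
- move=> n; have [_ _ /(_ lam lam0)] := hP n; apply: le_trans.
  rewrite mulr_sumr big_mkcond le_eqVlt; apply/orP; left; apply/eqP.
  rewrite [RHS]big_mkcond; apply: eq_bigr => a _; rewrite /h'/=.
  by case: ifP; rewrite ?mulr1 ?mulr0// mulrC.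
Qed.

End finite_exponent.
End transference.

(** * Transference of failures *)

Section transference_failure.
Context {R : realType} (Bk : nat -> block R) (kappa : R) (kappa_ge1 : 1 <= kappa).
Local Notation X := (glued R Bk).
Local Notation gpt := (gpt Bk).
Local Notation mu := (gmu Bk).
Local Notation rho := (grho Bk).
Local Notation c := (gcoef Bk).
Local Notation gop := (gop Bk kappa).

Section extension.
Variables (n : nat) (f : pt (Bk n) -> R).

Definition extend (x : X) : R := untag 0 f x.

Lemma extendE a : extend (gpt n a) = f a.
Proof. by exact: (untagE 0 f (erefl : tag (gpt n a) = n)). Qed.

Lemma extend_out x : tag x != n -> extend x = 0.
Proof. exact: untag_dflt. Qed.

Hypothesis f0 : forall a, 0 <= f a.

Lemma extend_ge0 x : 0 <= extend x.
Proof.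
have [e|/extend_out->//] := eqVneq (tag x) n.
by rewrite /extend (untagE 0 f e).
Qed.

Lemma gint_extend : (\int[mu]_x (extend x)%:E = (c n * \sum_a wt a * f a)%:E)%E.
Proof.
rewrite (gint_local Bk n).
- rewrite mulr_sumr -sumEFin; apply: eq_bigr => a _.
  by rewrite extendE -EFinM mulrA.
- by move=> x; rewrite lee_fin extend_ge0.
- by move=> x /extend_out ->.
Qed.

End extension.

Lemma extend_powR n (f : pt (Bk n) -> R) p x : p != 0 -> (forall a, 0 <= f a) ->
  `|extend n f x| `^ p = extend n (fun a => f a `^ p) x.
Proof.
move=> p0 f0; have [e|xn] := eqVneq (tag x) n; last by rewrite !extend_out// normr0 powR0.
by rewrite /extend (untagE 0 f e) (untagE 0 (fun a => f a `^ p) e) ger0_norm.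
Qed.

Lemma gop_extend_ge cent n (f : pt (Bk n) -> R) a t : (forall a, 0 <= f a) ->
  0 <= t -> (t = 0 \/ exists y s, [/\ 0 < s, kappa * s <= 1, relevant cent a y s &
     t * mass (bball y (kappa * s)) <= \sum_(z | bball y s z) wt z * f z]) ->
  (t%:E <= gop cent (extend n f) (gpt n a))%E.
Proof.
move=> f0 t0 [->|[y [s [s0 ks rel H]]]]; first exact: gop_ge0.
apply: (@le_trans _ _ (kavg rho mu kappa (extend n f) (gpt n y) s)); last first.
  by apply: gop_lb => //; exact: relevant_gpt.
rewrite kavg_localE// lee_fin ler_pdivlMr; last first.
  apply: (lt_le_trans (wt_gt0 y)); apply: wt_le_mass; apply: bball_center.
  by rewrite mulr_gt0// (lt_le_trans ltr01).
apply: (le_trans H); rewrite le_eqVlt; apply/orP; left; apply/eqP.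
by apply: eq_bigr => b _; rewrite extendE ger0_norm.
Qed.

Section finite_exponent.
Variables (p : R) (p1 : 1 <= p).

Let p0 : 0 < p. Proof. exact: lt_le_trans p1. Qed.

Lemma gint_extend_powR n (f : pt (Bk n) -> R) : (forall a, 0 <= f a) ->
  (\int[mu]_x (`|(EFin \o extend n f) x| `^ p) = (c n * \sum_a wt a * f a `^ p)%:E)%E.
Proof.
move=> f0; rewrite (gint_powR Bk p); under eq_integral do rewrite extend_powR ?gt_eqF//.
by rewrite gint_extend// => a; exact: powR_ge0.
Qed.

Lemma extend_Lp n (f : pt (Bk n) -> R) : (forall a, 0 <= f a) ->
  in_Lp mu p%:E (extend n f).
Proof.
by move=> f0; split => //; rewrite gLnormE// gint_extend_powR// poweR_EFin ltry.
Qed.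

(** A bad function on one block, extended by zero, keeps its averages over the witnessing balls, and
    the normalizing factor cancels. *)
Lemma glued_strong_fails cent :
  (forall C, exists n, bstrong_fails kappa (Bk n) cent p C) ->
  ~ strong_type mu (gop cent) p%:E.
Proof.
move=> H [C CP]; pose C0 := Num.max C 0.
have C00 : 0 <= C0 by rewrite le_max lexx orbT.
(* The local inequalities compare p-th powers of norms, hence the constant [C0 ^ p]. *)
have [n [f [h [f0 h0 hf]]]] := H (C0 `^ p).
apply/negP; rewrite -leNgt -(ler_pM2l (gcoef_gt0 Bk n)) mulrCA -lee_fin [leRHS]EFinM.
rewrite -(gint_extend_powR n f f0) -[X in (X <= _)%E]gint_extend; last first.
  by move=> a; exact: powR_ge0.
have NC : ('N[mu]_p%:E[gop cent (extend n f)] <= C0%:E * 'N[mu]_p%:E[EFin \o extend n f])%E.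
  apply: (le_trans (CP _ (extend_Lp n f f0))).
  by apply: lee_wpmul2r; [exact: Lnorm_ge0|rewrite lee_fin le_max lexx].
rewrite -!poweR_Lnorm ?gt_eqF// -poweR_EFin -poweRM ?lee_fin ?Lnorm_ge0//.
apply: (@le_trans _ _ ('N[mu]_p%:E[gop cent (extend n f)] `^ p)%E); last first.
  apply: gt0_ler_poweR; rewrite ?(ltW p0)//.
  - by rewrite in_itv/= leey andbT Lnorm_ge0.
  - by rewrite in_itv/= leey andbT mule_ge0 ?lee_fin ?Lnorm_ge0.
rewrite poweR_Lnorm ?gt_eqF//; apply: ge0_le_integral => //.
  by move=> x _; rewrite lee_fin extend_ge0// => a; exact: powR_ge0.
move=> [m a] _; have [e|mn] := eqVneq m n; last first.
  by rewrite extend_out// poweR_ge0.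
case: n / e f f0 h h0 hf {NC} => f f0 h h0 hf.
rewrite -[existT _ m a]/(gpt m a).
rewrite extendE -poweR_EFin gee0_abs ?gop_ge0//; apply: gt0_ler_poweR; rewrite ?(ltW p0)//.
- by rewrite in_itv/= leey lee_fin h0.
- by rewrite in_itv/= leey gop_ge0.
by apply: gop_extend_ge => //; exact: hf.
Qed.

Lemma glued_weak_fails cent :
  (forall C, exists n, bweak_fails kappa (Bk n) cent p C) ->
  ~ weak_type mu (gop cent) p%:E.
Proof.
move=> H [C CP]; pose C0 := Num.max C 0.
have C00 : 0 <= C0 by rewrite le_max lexx orbT.
have [n [f [lam [A [f0 lam0 Af]]]]] := H (C0 `^ p).
apply/negP; rewrite -leNgt -(ler_pM2l (gcoef_gt0 Bk n)) mulrCA [leRHS]mulrCA.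
rewrite -lee_fin [leLHS]EFinM [leRHS]EFinM.
rewrite -(gint_extend_powR n f f0).
have NC : (lam%:E * mu [set x | lam%:E < gop cent (extend n f) x] `^ p^-1
   <= C0%:E * 'N[mu]_p%:E[EFin \o extend n f])%E.
  apply: (le_trans (CP _ (extend_Lp n f f0) lam lam0)).
  by apply: lee_wpmul2r; [exact: Lnorm_ge0|rewrite lee_fin le_max lexx].
rewrite -!poweR_Lnorm ?gt_eqF// -[(C0 `^ p)%:E]poweR_EFin -poweRM ?lee_fin ?Lnorm_ge0//.
apply: (@le_trans _ _ ((lam%:E * mu [set x | lam%:E < gop cent (extend n f) x] `^ p^-1) `^ p)%E); last first.
  apply: gt0_ler_poweR; rewrite ?(ltW p0)//.
  - by rewrite in_itv/= leey andbT mule_ge0 ?poweR_ge0// lee_fin ltW.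
  - by rewrite in_itv/= leey andbT mule_ge0 ?lee_fin ?Lnorm_ge0.
rewrite poweRM ?poweR_ge0 ?lee_fin ?(ltW lam0)// -poweRrM mulVf ?gt_eqF// poweRe1//.
rewrite poweR_EFin lee_wpmul2l ?lee_fin ?powR_ge0//.
have -> : (c n * \sum_(x | A x) wt x)%:E = (\int[mu]_x (extend n (fun a => (A a)%:R) x)%:E)%E.
  rewrite gint_extend//; congr (_ * _)%:E; rewrite big_mkcond; apply: eq_bigr => a _.
  by case: (A a); rewrite ?mulr1 ?mulr0.
rewrite gmuE; apply: ge0_le_integral => //.
  by move=> x _; rewrite lee_fin extend_ge0.
move=> [m a] _; have [e|mn] := eqVneq m n; last first.
  by rewrite extend_out// lee_fin.
case: n / e f f0 A Af {NC} => f f0 A Af.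
rewrite -[existT _ m a]/(gpt m a).
rewrite extendE lee_fin indicE; case: (boolP (A a)) => // Aa.
rewrite mem_set//=.
have [y [s [s0 ks rel]]] := Af a Aa => lamH.
rewrite (@lt_le_trans _ _ (((\sum_(z | bball y s z) wt z * f z) / mass (bball y (kappa * s)))%:E))//.
  rewrite lte_fin ltr_pdivlMr//.
  apply: (lt_le_trans (wt_gt0 y)); apply: wt_le_mass; apply: bball_center.
  by rewrite mulr_gt0// (lt_le_trans ltr01).
have M0 : 0 < mass (bball y (kappa * s)).
  apply: (lt_le_trans (wt_gt0 y)); apply: wt_le_mass; apply: bball_center.
  by rewrite mulr_gt0// (lt_le_trans ltr01).
apply: gop_extend_ge => //.
  by rewrite divr_ge0 ?(ltW M0)//; apply: sumr_ge0 => z _; rewrite mulr_ge0 ?wt_ge0.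
by right; exists y, s; split => //; rewrite divfK// gt_eqF.
Qed.

End finite_exponent.

(** Every singleton contains a ball and so has positive measure; hence null sets are empty. *)
Lemma ae_everywhere (P : X -> Prop) : (\forall x \ae mu, P x) -> forall x, P x.
Proof.
move=> [A [_ A0 PA]] x; apply: contrapT => nP.
have [_ _ _ /(_ x)] := gmetric_measure_space Bk.
have [e e0 He] := grho_open Bk [set x] x erefl.
move=> /(_ e e0) /andP[+ _]; apply/negP; rewrite -leNgt -A0.
by apply: le_measure; rewrite ?inE// => y /He ->; exact: PA.
Qed.

(** The essential supremum bounds [f] everywhere, and the dilated ball in the denominator is the
    larger one. *)
Lemma glued_strong_oo cent : strong_type mu (gop cent) +oo%E.
Proof.
exists 1 => f _; rewrite mul1e unlock; have /andP[-> _] := gmu_setT Bk.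
set S := ess_sup_inf.ess_sup mu (abse \o (EFin \o f)).
have fS x : (`|f x|%:E <= S)%E.
  by move: x; apply: ae_everywhere; exact: (@ess_sup_inf.ess_sup_ge _ _ _ mu (abse \o (EFin \o f))).
have S0 : (0 <= S)%E by apply: le_trans (fS point); rewrite lee_fin.
apply/ess_sup_inf.ess_supP; apply: nearW => x /=; rewrite gee0_abs ?gop_ge0//.
apply: gop_ub => y s s0 _; rewrite /kavg.
have [_ _ _ mball_fin] := gmetric_measure_space Bk.
have ks0 : 0 < kappa * s by rewrite mulr_gt0// (lt_le_trans ltr01).
have /andP[M0 Moo] := mball_fin y _ ks0.
set M := fine _; have ME : (M%:E = mu (mball rho y (kappa * s)))%E.
  by rewrite /M fineK// ge0_fin_numE// ltW.
have M0' : 0 < M by rewrite -lte_fin ME.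
rewrite lee_pdivrMl//.
apply: (@le_trans _ _ (\int[mu]_(z in mball rho y s) cst S z)%E).
  by apply: ge0_le_integral => // z _; exact: fS.
rewrite integral_cst// ME muleC lee_wpmul2r//.
by apply: le_measure; rewrite ?inE// => z; rewrite /mball/= => /lt_le_trans; apply; rewrite ler_peMl// ltW.
Qed.

Lemma glued_types cent Qs Qw p : family_spec kappa Bk cent Qs Qw ->
  Qs +oo%E -> Qw +oo%E -> (1 <= p)%E ->
  (strong_type mu (gop cent) p <-> Qs p) /\ (weak_type mu (gop cent) p <-> Qw p).
Proof.
move=> spec Qsoo Qwoo; case: p => [p|_|//]; last first.
  by split; split => // _; exact: glued_strong_oo.
rewrite lee_fin => p1; have [a b a' b'] := spec p p1; split; split.
- move=> st; apply: contrapT => /b H; exact: glued_strong_fails H st.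
- by move=> /a; exact: glued_strong.
- move=> st; apply: contrapT => /b' H; exact: glued_weak_fails H st.
- by move=> /a'; exact: glued_weak.
Qed.

End transference_failure.

(** * Weighted stars *)

Record small_metric (R : realType) (T : eqType) := SmallMetric {
  smdist :> T -> T -> R;
  smdist_refl : forall x, smdist x x = 0;
  smdist_gt0 : forall x y, x != y -> 0 < smdist x y;
  smdist_sym : forall x y, smdist x y = smdist y x;
  smdist_tri : forall x y z, smdist x z <= smdist x y + smdist y z;
  smdist_lt1 : forall x y, smdist x y < 1 }.

(* A centre [None], a leaf [Some (true, l)] and a light point
   [Some (false, l)] for each [l]. *)
Notation star L := (option (bool * L)).

Section star.
Context {R : realType} {L : finType} (w : L -> R) (w_ge1 : forall l, 1 <= w l).

Definition star_wt (x : star L) : R :=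
  if x is Some (b, l) then if b then w l else #|L|%:R^-1 else 1.

Lemma star_wt_gt0 x : 0 < star_wt x.
Proof.
case: x => [[[] l]|] //=; first exact: lt_le_trans (w_ge1 l).
by rewrite invr_gt0 ltr0n; apply/card_gt0P; exists l.
Qed.

Definition is_leaf (x : star L) := if x is Some (b, l) then b else false.

Definition star_leaf (l : L) : star L := Some (true, l).
Definition star_tip (l : L) : star L := Some (false, l).

Lemma star_leaf_inj : injective star_leaf. Proof. by move=> l k []. Qed.

Lemma is_leafE x : is_leaf x = (x \in codom star_leaf).
Proof.
apply/idP/codomP => [|[l ->]//]; case: x => [[[] l]|]//= _; by exists l.
Qed.

Lemma sum_star (F : star L -> R) :
  \sum_x F x = F None + (\sum_l F (star_leaf l) + \sum_l F (star_tip l)).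
Proof.
rewrite (bigD1 None)//=; congr (_ + _).
rewrite (reindex_omap Some id)/=; last by case.
rewrite (eq_bigl xpredT); last by move=> bl; rewrite eqxx.
rewrite (eq_bigr (fun bl => F (Some (bl.1, bl.2)))); last by case.
by rewrite -(pair_bigA _ (fun b l => F (Some (b, l))))/= big_bool.
Qed.

Variable d : small_metric R (star L).

Definition star_block : block R := @Block R (star L) None star_wt d star_wt_gt0
  (smdist_refl _ _ d) (smdist_gt0 _ _ d) (smdist_sym _ _ d)
  (smdist_tri _ _ d) (smdist_lt1 _ _ d).

Lemma star_mass (A : pred (star L)) : mass (B := star_block) A =
  (A None)%:R + (\sum_(l | A (star_leaf l)) w l +
                 \sum_(l | A (star_tip l)) #|L|%:R^-1).
Proof.
rewrite /mass big_mkcond sum_star; congr (_ + (_ + _)).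
- by case: ifP.
- by rewrite [RHS]big_mkcond.
- by rewrite [RHS]big_mkcond.
Qed.

Lemma sum_tips (P : pred L) : \sum_(l | P l) (#|L|%:R^-1 : R) <= 1.
Proof.
rewrite sumr_const -(mulr_natl (#|L|%:R^-1)).
have [L0|L0] := eqVneq #|L| 0%N; first by rewrite L0 invr0 mulr0.
by rewrite ler_pdivrMr ?ltr0n ?lt0n// mul1r ler_nat max_card.
Qed.

Lemma mass_core (A : pred (star L)) : (forall x, A x -> ~~ is_leaf x) ->
  mass (B := star_block) A <= 2.
Proof.
move=> AL; rewrite star_mass big_pred0 ?add0r; last first.
  by move=> l; apply/negbTE/negP => /AL.
by have := sum_tips (fun l => A (star_tip l)); case: (A None) => /=; lra.
Qed.

Hypothesis tip_center : forall l z, z != star_tip l -> d (star_tip l) None <= d (star_tip l) z.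

Context (kappa : R) (kappa_ge1 : 1 <= kappa).

Local Notation ball := (bball (B := star_block)).
Local Notation M y s := (mass (ball y (kappa * s))).

Lemma ball_mem y s u : 0 < s -> d y u < s -> star_wt u <= M y s.
Proof.
by move=> s0 yu; apply: (wt_le_mass star_block); exact: bball_dilate.
Qed.

(** The ball contains [y], of mass at least 1 unless [y] is a light point; in that case [None] is
    the nearest other point and belongs to the ball too. *)
Lemma ball_mass_ge1 y s u v : 0 < s -> u != v -> d y u < s -> d y v < s -> 1 <= M y s.
Proof.
move=> s0 uv yu yv.
have yy : d y y < s by rewrite smdist_refl.
case: y => [[[] l]|] in yu yv yy *.
- by apply: le_trans (w_ge1 l) _; exact: (ball_mem _ _ _ s0 yy).
- apply: (ball_mem (star_tip l) s None s0).
  have [ul|ul] := eqVneq u (star_tip l).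
    by apply: (le_lt_trans (tip_center l v _) yv); rewrite -ul eq_sym.
  exact: (le_lt_trans (tip_center l u ul) yu).
- exact: (ball_mem None s None s0 yy).
Qed.

Lemma kernel_term (a k m : R) : 0 < a -> a <= m -> a^-1 <= k -> 1 <= k * m.
Proof.
move=> a0 am ak; have k0 : 0 <= k by apply: le_trans ak; rewrite invr_ge0 ltW.
apply: (@le_trans _ _ (k * a)); last by rewrite ler_wpM2l.
by rewrite -ler_pdivrMr// mul1r.
Qed.

(** The diagonal part covers [z = x]; the other part covers every [x] that is not a leaf, since
    balls with two points have dilations of mass at least 1. *)
Definition base_kernel (x z : star L) : R :=
  (x == z)%:R / star_wt x + (~~ is_leaf x)%:R.

Lemma base_kernel_ge0 x z : 0 <= base_kernel x z.
Proof. by rewrite addr_ge0// divr_ge0// ltW// star_wt_gt0. Qed.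

Lemma sum_base_kernel z : \sum_x star_wt x * base_kernel x z <= 3.
Proof.
under eq_bigr do rewrite mulrDr mulrCA mulfV ?gt_eqF ?star_wt_gt0// mulr1.
rewrite big_split/= (_ : 3 = 1 + 2 :> R); last by ring.
apply: lerD.
  rewrite (bigD1 z)//= eqxx big1 ?addr0// => x /negPf ->//.
apply: le_trans (mass_core (fun x => ~~ is_leaf x) _) => //.
rewrite /mass [leRHS]big_mkcond; apply: ler_sum => x _ /=.
by case: (is_leaf x); rewrite ?mulr0 ?mulr1.
Qed.

Lemma base_kernelP x y s z : 0 < s -> d y x < s -> d y z < s ->
  (x == z) || ~~ is_leaf x -> 1 <= base_kernel x z * M y s.
Proof.
move=> s0 yx yz; have [<- _|xz /= xL] := eqVneq x z.
  apply: (kernel_term (star_wt x)); first exact: star_wt_gt0.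
    exact: ball_mem.
  by rewrite /base_kernel eqxx mul1r lerDl.
apply: (kernel_term 1) => //; first exact: ball_mass_ge1 yx yz.
by rewrite /base_kernel xL (negPf xz) mul0r add0r invr1.
Qed.

Section spread.
(** A ball containing two leaves contains all of them, hence has mass at least [W]. *)
Hypothesis leaves_far : forall y k l l', l != l' ->
  d y (star_leaf k) <= Num.max (d y (star_leaf l)) (d y (star_leaf l')).

Let W := \sum_l w l.

Let W_ge0 : 0 <= W.
Proof. by apply: sumr_ge0 => l _; apply: le_trans (w_ge1 l). Qed.

Definition spread_kernel (x z : star L) : R := base_kernel x z + (is_leaf x)%:R / W.

Lemma leaves_mass y s : (forall k, d y (star_leaf k) < kappa * s) -> W <= M y s.
Proof.
move=> yk; rewrite star_mass (eq_bigl xpredT); last by move=> l; exact: yk.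
rewrite addrCA lerDl addr_ge0//.
by apply: sumr_ge0 => l _; rewrite invr_ge0.
Qed.

Lemma sum_spread_kernel z : \sum_x star_wt x * spread_kernel x z <= 4.
Proof.
under eq_bigr do rewrite mulrDr.
rewrite big_split/= (_ : 4 = 3 + 1 :> R); last by ring.
apply: lerD; first exact: sum_base_kernel.
rewrite sum_star/= mul0r mulr0 add0r [X in _ + X]big1 ?addr0; last first.
  by move=> l _; rewrite mulr0.
rewrite -mulr_suml mul1r -/W; have [->|W0] := eqVneq W 0; first by rewrite mul0r.
by rewrite mulfV.
Qed.

Lemma far_leaves_kernel x y s z : is_leaf x -> 0 < s ->
  (forall k, d y (star_leaf k) < kappa * s) -> 1 <= spread_kernel x z * M y s.
Proof.
case: x => [[[] l]|]// _ s0 yk.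
apply: (kernel_term W).
- apply: (lt_le_trans (lt_le_trans ltr01 (w_ge1 l))).
  by rewrite /W (bigD1 l)//= lerDl; apply: sumr_ge0 => k _; apply: le_trans (w_ge1 k).
- exact: leaves_mass.
- by rewrite /spread_kernel/= mul1r lerDr base_kernel_ge0.
Qed.

(** The exceptional interactions are those of a leaf with the core, that is, with the centre and the
    light points. *)
Lemma spread_avg_kernel :
  avg_kernel kappa star_block false is_leaf (fun _ z => ~~ is_leaf z) spread_kernel 4.
Proof.
split.
- by move=> x z; rewrite addr_ge0 ?base_kernel_ge0// divr_ge0.
- exact: sum_spread_kernel.
move=> x y s z s0 /= yx yz xz.
have [H|] := boolP ((x == z) || ~~ is_leaf x).
  apply: (le_trans (base_kernelP x y s z s0 yx yz H)).
  by rewrite ler_wpM2r ?mass_ge0// lerDl divr_ge0.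
rewrite negb_or negbK => /andP[nxz xL]; move: xz; rewrite xL/= negbK => zL.
apply: far_leaves_kernel => // k.
case: x => [[[] l]|]// in yx nxz xL *; case: z => [[[] l']|]// in yz nxz zL *.
apply: (@lt_le_trans _ _ s); last by rewrite ler_peMl// ltW.
apply: (le_lt_trans (leaves_far y k l l' _)); last by rewrite gt_max yx.
by apply: contraNneq nxz => ->.
Qed.

(** A ball centred at a leaf that meets the core outside its own light point contains all leaves.
    This removes the exceptional interactions for the centred operator. *)
Hypothesis leaf_core : forall l z k, ~~ is_leaf z -> z != star_tip l ->
  d (star_leaf l) (star_leaf k) <= d (star_leaf l) z.

(** Covers a leaf and its own light point; each light point belongs to one leaf, so the column sums
    are at most 1. *)
Definition tip_kernel (x z : star L) : R :=
  if (x, z) is (Some (true, l), Some (false, k)) then (l == k)%:R / w l else 0.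

Lemma tip_kernel_ge0 x z : 0 <= tip_kernel x z.
Proof.
case: x => [[[] l]|]//; case: z => [[[] k]|]//=.
by rewrite divr_ge0// (le_trans _ (w_ge1 l)).
Qed.

Lemma sum_tip_kernel z : \sum_x star_wt x * tip_kernel x z <= 1.
Proof.
rewrite sum_star/= mulr0 add0r [X in _ + X]big1 ?addr0 => [|l _]; last by rewrite mulr0.
case: z => [[[] k]|]/=; try by rewrite big1// => l _; rewrite mulr0.
rewrite /tip_kernel/= (bigD1 k)//= eqxx mul1r.
rewrite mulfV ?gt_eqF ?(lt_le_trans ltr01)// big1 ?addr0// => l /negPf ->.
by rewrite mul0r mulr0.
Qed.

Lemma tip_kernelP l y s : 0 < s -> d y (star_leaf l) < s ->
  1 <= tip_kernel (star_leaf l) (star_tip l) * M y s.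
Proof.
move=> s0 yl; apply: (kernel_term (w l)).
- exact: lt_le_trans (w_ge1 l).
- exact: (ball_mem y s (star_leaf l)).
- by rewrite /tip_kernel/= eqxx mul1r.
Qed.

Lemma spread_avg_kernel_centered : avg_kernel kappa star_block true pred0
  (fun _ => pred0) (fun x z => spread_kernel x z + tip_kernel x z) 5.
Proof.
have [S0 S4 SP] := spread_avg_kernel.
split.
- by move=> x z; rewrite addr_ge0 ?tip_kernel_ge0.
- move=> z; under eq_bigr do rewrite mulrDr.
  rewrite big_split/= (_ : 5 = 4 + 1 :> R); last by ring.
  by apply: lerD; [exact: S4|exact: sum_tip_kernel].
move=> x y s z s0 /eqP -> yz _; rewrite mulrDl.
have [H|] := boolP (~~ (is_leaf x && ~~ is_leaf z)).
  apply: (@le_trans _ _ (spread_kernel x z * M x s)).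
    by apply: SP => //=; rewrite smdist_refl.
  by rewrite lerDl mulr_ge0 ?tip_kernel_ge0 ?mass_ge0.
rewrite negbK => /andP[xL zL]; case: x => [[[] l]|]// in xL yz *.
have [->|zl] := eqVneq z (star_tip l).
  apply: (@le_trans _ _ (tip_kernel (star_leaf l) (star_tip l) * M (star_leaf l) s)).
    by apply: tip_kernelP => //; rewrite smdist_refl.
  by rewrite lerDr mulr_ge0 ?S0 ?mass_ge0.
apply: (@le_trans _ _ (spread_kernel (star_leaf l) z * M (star_leaf l) s)).
  apply: far_leaves_kernel => // k.
  apply: (@lt_le_trans _ _ s); last by rewrite ler_peMl// ltW.
  exact: (le_lt_trans (leaf_core l z k zL zl)).
by rewrite lerDl mulr_ge0 ?tip_kernel_ge0 ?mass_ge0.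
Qed.

End spread.


End star.

(** * Stars with rapidly growing weights *)

Section nested.
Context {R : realType}.

(* Fast enough growth makes the total of the smaller weights negligible. *)
Definition nested_wt (i : nat) : R := 2 ^+ (i * i).

Lemma nested_wt_gt0 i : 0 < nested_wt i. Proof. by rewrite exprn_gt0. Qed.

Lemma nested_wt_ge1 i : 1 <= nested_wt i.
Proof. by rewrite exprn_ege1// ler1n. Qed.

Lemma nested_wtS i : nested_wt i.+1 = 2 * 4 ^+ i * nested_wt i.
Proof.
rewrite /nested_wt (_ : i.+1 * i.+1 = i * i + (2 * i + 1))%N; last by ring.
rewrite exprD addn1 exprS (exprM 2 2 i) (_ : 2 ^+ 2 = 4 :> R); last by ring.
by rewrite [LHS]mulrC.
Qed.

Lemma sum_nested_wt j : \sum_(i < j.+1) nested_wt i <= 2 * nested_wt j.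
Proof.
elim: j => [|j IH]; first by rewrite big_ord1 ler_peMl ?ler1n// ltW// nested_wt_gt0.
rewrite big_ord_recr/= nested_wtS; apply: (le_trans (lerD IH (lexx _))).
have : 1 <= 4 ^+ j :> R by rewrite exprn_ege1// ler1n.
have := nested_wt_gt0 j; set x := nested_wt j; set y := 4 ^+ j => x0 y1.
have : x <= y * x by rewrite ler_peMl// ltW.
by rewrite -mulrA; lra.
Qed.

(** The 2 accounts for the core. The factor [2^-1 ^+ j] makes the ratios to [nested_wt j] summable
    after raising to any positive power. *)
Lemma sum_smaller_nested_wt j :
  2 + \sum_(i < j) nested_wt i <= 4 * 2^-1 ^+ j * nested_wt j.
Proof.
elim: j => [|j IH].
  by rewrite big_ord0 expr0 /nested_wt muln0 expr0; lra.
have [->|j0] := eqVneq j 0%N.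
  by rewrite big_ord1 /nested_wt muln0 muln1 expr0 !expr1; lra.
rewrite big_ord_recr/= addrA; apply: (le_trans (lerD IH (lexx _))).
rewrite nested_wtS exprS.
have -> : 4 * (2^-1 * 2^-1 ^+ j) * (2 * 4 ^+ j * nested_wt j) =
    4 * ((2^-1 * 4) ^+ j) * nested_wt j by rewrite exprMn; field.
have x0 := nested_wt_gt0 j; set x := nested_wt j in x0 *.
have -> : 2^-1 * 4 = 2 :> R by field.
have b2 : 2 <= 2 ^+ j :> R by rewrite -[leLHS]expr1 ler_weXn2l ?ler1n// lt0n.
have a2 : 2^-1 ^+ j <= 2^-1 :> R.
  by rewrite exprVn lef_pV2 ?posrE ?exprn_gt0.
have ax : 2^-1 ^+ j * x <= 2^-1 * x by rewrite ler_wpM2r// ltW.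
have bx : 2 * x <= 2 ^+ j * x by rewrite ler_wpM2r// ltW.
by rewrite -!mulrA; lra.
Qed.

Lemma sum_geometric_le (q : R) m : 0 <= q < 1 -> \sum_(i < m) q ^+ i <= (1 - q)^-1.
Proof.
move=> /andP[q0 q1]; rewrite -[leRHS]mul1r ler_pdivlMr ?subr_gt0//.
elim: m => [|m IH]; first by rewrite big_ord0 mul0r.
have -> : (\sum_(i < m.+1) q ^+ i) * (1 - q) = 1 - q ^+ m.+1.
  rewrite -[in RHS](expr1n _ m.+1) subrXX mulrC; congr (_ * _).
  by apply: eq_bigr => i _; rewrite expr1n mul1r.
by rewrite gerBl exprn_ge0.
Qed.

Lemma sum_nested_wt_ratio m : \sum_(i < m) nested_wt i / nested_wt i.+1 <= 2.
Proof.
have -> : 2 = (1 - 2^-1)^-1 :> R by field.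
apply: le_trans (@sum_geometric_le 2^-1 m _); last first.
  by rewrite invr_ge0 ler0n invf_lt1 ?ltr1n.
apply: ler_sum => i _; rewrite nested_wtS ler_pdivrMr; last first.
  by rewrite !mulr_gt0 ?exprn_gt0 ?nested_wt_gt0.
rewrite mulrA ler_peMl ?(ltW (nested_wt_gt0 i))//.
have -> : 2^-1 ^+ i * (2 * 4 ^+ i) = 2 * (2^-1 * 4) ^+ i :> R by rewrite exprMn; ring.
have -> : 2^-1 * 4 = 2 :> R by field.
by rewrite -exprS exprn_ege1// ler1n.
Qed.

(** The sum is at most twice its largest term; this is what weak type [(1, 1)] requires. *)
Lemma sum_nested_wt_lt m (t : R) : 0 < t ->
  \sum_(i < m | nested_wt i < t) nested_wt i <= 2 * t.
Proof.
move=> t0; elim: m => [|m IH]; first by rewrite big_ord0 mulr_ge0// ltW.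
have [mt|mt] := ltP (nested_wt m) t; last first.
  by rewrite big_mkcond big_ord_recr/= ltNge mt addr0 -big_mkcond.
apply: (@le_trans _ _ (2 * nested_wt m)); last by rewrite ler_wpM2l// ltW.
apply: le_trans (sum_nested_wt m); rewrite [leLHS]big_mkcond; apply: ler_sum => i _.
by case: ifP => // _; rewrite ltW// nested_wt_gt0.
Qed.

Variable m : nat.

Local Notation w := (fun i : 'I_m => nested_wt i).

Let w_ge1 (i : 'I_m) : 1 <= w i. Proof. exact: nested_wt_ge1. Qed.

Local Notation S := (star 'I_m).

(** The exceptional interactions of a leaf: the core and the preceding leaves. *)
Definition smaller (x z : S) : bool :=
  if z is Some (true, i) then if x is Some (true, j) then (i < j)%N else false
  else true.

(** A ball containing a later leaf [i] weighs at least [nested_wt i], which dominates the sum of all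
    masses up to [i]. *)
Definition nested_kernel (x z : S) : R := base_kernel w x z +
  (if (x, z) is (Some (true, j), Some (true, i)) then (j <= i)%N%:R / nested_wt i else 0).

Lemma sum_nested_kernel (d : small_metric R S) z :
  \sum_x star_wt w x * nested_kernel x z <= 5.
Proof.
under eq_bigr do rewrite mulrDr.
rewrite big_split/= (_ : 5 = 3 + 2 :> R); last by ring.
apply: lerD; first exact: (sum_base_kernel w w_ge1 d).
rewrite sum_star/= mulr0 add0r [X in _ + X]big1 ?addr0 => [|l _]; last by rewrite mulr0.
case: z => [[[] i]|]/=; try by rewrite big1// => l _; rewrite mulr0.
under eq_bigr do rewrite mulrA.
rewrite -mulr_suml ler_pdivrMr ?nested_wt_gt0//.
apply: le_trans (sum_nested_wt i).
rewrite (big_ord_widen m nested_wt (ltn_ord i)) [leRHS]big_mkcond.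
apply: ler_sum => j _; rewrite ltnS; case: (j <= i)%N; by rewrite ?mulr1 ?mulr0.
Qed.

Variable d : small_metric R S.
Hypothesis tip_center : forall l z, z != star_tip l -> d (star_tip l) None <= d (star_tip l) z.
Context (kappa : R) (kappa_ge1 : 1 <= kappa).

Lemma nested_avg_kernel : avg_kernel kappa (star_block w w_ge1 d) false is_leaf
  smaller nested_kernel 5.
Proof.
have idx0 (x z : S) : 0 <= (if (x, z) is (Some (true, j), Some (true, i))
    then (j <= i)%N%:R / nested_wt i else 0 : R).
  by case: x => [[[] j]|]//; case: z => [[[] i]|]//; rewrite divr_ge0// ltW// nested_wt_gt0.
split.
- by move=> x z; rewrite addr_ge0 ?base_kernel_ge0// => l; exact: w_ge1.
- exact: sum_nested_kernel.
move=> x y s z s0 /= yx yz xz.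
have [H|] := boolP ((x == z) || ~~ is_leaf x).
  apply: (le_trans (base_kernelP w w_ge1 d tip_center kappa kappa_ge1 x y s z s0 yx yz H)).
  by rewrite ler_wpM2r ?mass_ge0// lerDl.
rewrite negb_or negbK => /andP[nxz xL].
case: x => [[[] j]|]// in yx nxz xL xz *.
case: z => [[[] i]|]// in yz nxz xz *.
move: xz; rewrite /= -leqNgt => ji.
apply: (kernel_term (nested_wt i)); first exact: nested_wt_gt0.
  exact: (ball_mem w w_ge1 d kappa kappa_ge1 y s (star_leaf i)).
rewrite /nested_kernel ji mul1r lerDr; apply: base_kernel_ge0 => l; exact: w_ge1.
Qed.

Lemma mass_smaller (j : 'I_m) :
  mass (B := star_block w w_ge1 d) (smaller (star_leaf j)) <= 4 * 2^-1 ^+ j * nested_wt j.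
Proof.
apply: le_trans (sum_smaller_nested_wt j).
rewrite star_mass/= (big_ord_widen m nested_wt (ltnW (ltn_ord j))).
have := sum_tips (R := R) (fun l : 'I_m => smaller (star_leaf j) (star_tip l)).
rewrite /=; set a := \sum_(l | _) _; set b := \sum_(l | _) _; lra.
Qed.

(** A ball centred at a leaf and reaching beyond its own light point has a dilation containing the
    next, much heavier leaf. *)
Hypothesis next_leaf : forall (i j : 'I_m) z, j = i.+1 :> nat -> z != star_leaf i -> z != star_tip i ->
  d (star_leaf i) (star_leaf j) <= kappa * d (star_leaf i) z.

(** The last leaf has no successor and uses its own mass, which adds 1 to the column sums. *)
Definition next_kernel (x z : S) : R := base_kernel w x z + tip_kernel w x z +
  (if x is Some (true, i) then (nested_wt i.+1)^-1 + (i.+1 == m :> nat)%:R / nested_wt i else 0).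

Lemma next_avg_kernel : avg_kernel kappa (star_block w w_ge1 d) true pred0
  (fun _ => pred0) next_kernel 7.
Proof.
have nxt0 (x : S) : 0 <= (if x is Some (true, i)
    then (nested_wt i.+1)^-1 + (i.+1 == m :> nat)%:R / nested_wt i else 0 : R).
  by case: x => [[[] j]|]//; rewrite addr_ge0 ?divr_ge0 ?invr_ge0 ?(ltW (nested_wt_gt0 _)).
have b0 x z : 0 <= base_kernel w x z by apply: base_kernel_ge0 => l; exact: w_ge1.
have t0 x z : 0 <= tip_kernel w x z by apply: tip_kernel_ge0 => l; exact: w_ge1.
split.
- move=> x z; apply: addr_ge0; last exact: nxt0.
  by apply: addr_ge0; [exact: b0|exact: t0].
- move=> z; under eq_bigr do rewrite mulrDr [X in X + _]mulrDr.
  rewrite !big_split/= (_ : 7 = 3 + 1 + 3 :> R); last by ring.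
  apply: lerD; first apply: lerD.
  + exact: (sum_base_kernel w w_ge1 d).
  + by apply: sum_tip_kernel => l; exact: w_ge1.
  rewrite sum_star/= mulr0 add0r [X in _ + X]big1 ?addr0 => [|l _]; last by rewrite mulr0.
  under eq_bigr do rewrite mulrDr.
  rewrite big_split/= (_ : 3 = 2 + 1 :> R); last by ring.
  apply: lerD; first exact: sum_nested_wt_ratio.
  have wV (x : R) i : nested_wt i * (x / nested_wt i) = x.
    by rewrite mulrCA mulfV ?mulr1// gt_eqF// nested_wt_gt0.
  under eq_bigr do rewrite wV.
  case: m => [|n]; first by rewrite big_ord0.
  rewrite big_ord_recr/= eqxx big1 ?add0r// => i _.
  by rewrite eqSS ltn_eqF.
move=> x y s z s0 /eqP -> xz _; rewrite mulrDl.
have xx : d x x < s by rewrite smdist_refl.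
have M0 : 0 <= mass (B := star_block w w_ge1 d) (bball x (kappa * s)) by exact: mass_ge0.
have [H|] := boolP ((x == z) || ~~ is_leaf x).
  rewrite mulrDl -addrA.
  apply: (le_trans (base_kernelP w w_ge1 d tip_center kappa kappa_ge1 x x s z s0 xx xz H)).
  by rewrite lerDl addr_ge0// mulr_ge0.
rewrite negb_or negbK => /andP[nxz xL]; case: x => [[[] i]|]// in xx xz nxz xL M0 *.
have [->|zi] := eqVneq z (star_tip i).
  apply: (le_trans (tip_kernelP w w_ge1 d kappa kappa_ge1 i (star_leaf i) s s0 xx)).
  rewrite -mulrDl ler_wpM2r// -addrA addrCA lerDl; apply: addr_ge0 => //.
  exact: (nxt0 (star_leaf i)).
rewrite -mulrDl.
have bt0 : 0 <= base_kernel w (star_leaf i) z + tip_kernel w (star_leaf i) z.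
  by apply: addr_ge0; [exact: b0|exact: t0].
have [im|im] := eqVneq i.+1 m.
  apply: (kernel_term (nested_wt i)); first exact: nested_wt_gt0.
    exact: (ball_mem w w_ge1 d kappa kappa_ge1 (star_leaf i) s (star_leaf i)).
  apply: ler_wpDl => //; rewrite mul1r lerDr invr_ge0 ltW//; exact: nested_wt_gt0.
have jm : (i.+1 < m)%N by rewrite ltn_neqAle im ltn_ord.
apply: (kernel_term (nested_wt i.+1)); first exact: nested_wt_gt0.
  apply: (@wt_le_mass _ (star_block w w_ge1 d) _ (star_leaf (Ordinal jm))).
  apply: (le_lt_trans (next_leaf i (Ordinal jm) z erefl _ zi)); first by rewrite eq_sym.
  by rewrite ltr_pM2l// (lt_le_trans ltr01).
by apply: ler_wpDl => //; rewrite mul0r addr0.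
Qed.

End nested.

Arguments smaller {m}.
Arguments nested_kernel {R m}.

Section nested_families.
Context {R : realType} (kappa : R) (kappa_ge1 : 1 <= kappa).
Context (d : forall m, small_metric R (star 'I_m)).

Definition nested_block m : block R :=
  star_block (fun i : 'I_m => nested_wt i) (fun i => nested_wt_ge1 i) (d m).

Hypothesis tip_center : forall m l z, z != star_tip l ->
  d m (star_tip l) None <= d m (star_tip l) z.

(** For [p > 1] the bound on [mass (smaller x)] turns the strong sum into a geometric series. At
    [p = 1] each leaf contributes 1, so strong type fails as [m] grows, while the fast growth of the
    masses preserves weak type. *)
Lemma family_spec_nested cent :
  (forall m, reaches kappa (nested_block m) cent None is_leaf) ->
  family_spec kappa nested_block cent [set p | (1 < p)%E] [set p | (1 <= p)%E].
Proof.
move=> HR p p1.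
have p0 : 0 < p by exact: lt_le_trans p1.
have KP m : avg_kernel kappa (nested_block m) cent is_leaf
    smaller nested_kernel 5.
  by apply: kernel_centered; exact: (nested_avg_kernel m (d m) (tip_center m) kappa kappa_ge1).
have strong : 1 < p -> exists C, forall m, bstrong kappa (nested_block m) cent p C.
  move=> p1'; pose q : R := 2^-1 `^ (p - 1).
  have q1 : 0 <= q < 1.
    have : 2^-1 `^ (p - 1) < 1 `^ (p - 1) :> R.
      by apply: gt0_ltr_powR; rewrite ?subr_gt0 ?nnegrE ?invf_lt1 ?ltr1n.
    by rewrite powR1 powR_ge0.
  exists (2 `^ p * (2 `^ p * 5 + 2 `^ p * (4 `^ (p - 1) * (1 - q)^-1))) => m f f0.
  apply: (kernel_strong kappa kappa_ge1 (KP m)) => //.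
  rewrite (sum_all_leaves (fun m => 'I_m) nested_block (fun m => @star_leaf 'I_m)
    (fun m => @is_leaf 'I_m) (fun m => @star_leaf_inj 'I_m) (fun m => @is_leafE 'I_m) m).
  apply: (@le_trans _ _ (\sum_(i < m) 4 `^ (p - 1) * q ^+ i)); last first.
    by rewrite -mulr_sumr ler_wpM2l ?powR_ge0// sum_geometric_le.
  apply: ler_sum => i _.
  rewrite mulrCA (_ : wt _ = nested_wt i)// mul_powRN ?nested_wt_gt0//.
  have -> : q ^+ i = (2^-1 ^+ i) `^ (p - 1).
    by rewrite /q -!powR_mulrn ?powR_ge0// -!powRrM mulrC.
  rewrite -powRM ?exprn_ge0//.
  have -> : 1 - p = - (p - 1) by rewrite opprB.
  rewrite powRN ler_pdivrMr ?powR_gt0 ?nested_wt_gt0//.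
  rewrite -powRM ?mulr_ge0 ?exprn_ge0 ?(ltW (nested_wt_gt0 _))//.
  rewrite ge0_ler_powR ?subr_ge0 ?nnegrE ?mass_ge0//.
    by rewrite !mulr_ge0 ?exprn_ge0 ?(ltW (nested_wt_gt0 _)).
  exact: mass_smaller.
split.
- by rewrite /= lte_fin; exact: strong.
- move=> /= /negP; rewrite lte_fin -leNgt => p1' C.
  have {p1 p1'}pE : p = 1 by apply/eqP; rewrite eq_le p1 p1'.
  exists (Num.truncn (C * 4 `^ p)).+1.
  apply: (reaches_strong_fails kappa (nested_block _) cent None is_leaf p C) => //; first by rewrite pE.
  rewrite (sum_all_leaves (fun m => 'I_m) nested_block (fun m => @star_leaf 'I_m)
    (fun m => @is_leaf 'I_m) (fun m => @star_leaf_inj 'I_m) (fun m => @is_leafE 'I_m)).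
  rewrite [in ltRHS]pE subrr; under eq_bigr do rewrite powRr0.
  rewrite sumr_const card_ord.
  by rewrite pE; exact: truncnS_gt.
- move=> _; move: (p1); rewrite le_eqVlt => /orP[/eqP pE|/strong[C CP]]; last first.
    by exists C => m; exact: bstrong_bweak.
  exists (2 `^ p * (2 `^ p * 5 + 2 * (2 `^ p * 1))) => m f f0.
  apply: (@kernel_weak _ _ kappa_ge1 _ _ _ _ _ _ (KP m) p f p1 f0 2 1) => //.
  + by move=> x _; rewrite -pE subrr powRr0.
  + move=> t t0; rewrite (sum_leaves (fun m => 'I_m) nested_block (fun m => @star_leaf 'I_m)
      (fun m => @is_leaf 'I_m) (fun m => @star_leaf_inj 'I_m) (fun m => @is_leafE 'I_m) m
      (fun x => wt x < t)).
    by rewrite -pE powRr1 ?(ltW t0)//; exact: sum_nested_wt_lt.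
- by rewrite /= lee_fin p1.
Qed.

End nested_families.

(** * Metrics on stars *)

Section star_metrics.
Context {R : realType} {L : finType}.

(** A leaf is twice as far from the other leaves as from the centre, whence the threshold
    [kappa < 2]. *)
Definition equi_dist (x y : star L) : R :=
  if x == y then 0 else if (x == None) || (y == None) then 4^-1 else 2^-1.

Lemma equi_dist_refl x : equi_dist x x = 0. Proof. by rewrite /equi_dist eqxx. Qed.

Lemma equi_dist_gt0 x y : x != y -> 0 < equi_dist x y.
Proof. by rewrite /equi_dist => /negPf->; case: ifP. Qed.

Lemma equi_dist_sym x y : equi_dist x y = equi_dist y x.
Proof. by rewrite /equi_dist eq_sym orbC. Qed.

Lemma equi_dist_tri x y z : equi_dist x z <= equi_dist x y + equi_dist y z.
Proof.
rewrite /equi_dist; have [->|xy] := eqVneq x y; first by rewrite add0r.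
have [<-|yz] := eqVneq y z; first by rewrite (negPf xy) addr0.
by do ![case: ifP => _]; lra.
Qed.

Lemma equi_dist_lt1 x y : equi_dist x y < 1.
Proof. by rewrite /equi_dist; do ![case: ifP => _]; lra. Qed.

Definition equi_metric := SmallMetric R (star L) equi_dist equi_dist_refl
  equi_dist_gt0 equi_dist_sym equi_dist_tri equi_dist_lt1.

(** A light point is at distance 1/8 from its leaf and from the centre, and 3/8 from the other
    leaves, whence the threshold [kappa < 3]. Leaves are as far from each other as from the centre,
    so a ball around a leaf reaching the centre contains every leaf. *)
Definition tip_dist (x y : star L) : R :=
  match x, y with
  | None, None => 0
  | None, Some (b, _) | Some (b, _), None => if b then 2 else 1
  | Some (b, l), Some (b', l') =>
      if l == l' then if b == b' then 0 else 1 else if b == b' then 2 else 3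
  end / 8.

Lemma tip_dist_refl x : tip_dist x x = 0.
Proof. by case: x => [[b l]|]; rewrite /tip_dist ?eqxx mul0r. Qed.

Lemma tip_dist_gt0 x y : x != y -> 0 < tip_dist x y.
Proof.
move=> xy; rewrite /tip_dist divr_gt0//; move: xy.
by case: x y => [[[] l]|] [[[] k]|]//; have [->|_] := eqVneq l k; rewrite /= ?eqxx.
Qed.

Lemma tip_dist_sym x y : tip_dist x y = tip_dist y x.
Proof.
case: x y => [[b l]|] [[b' k]|]//=; rewrite /tip_dist.
by rewrite [l == k]eq_sym [b == b']eq_sym.
Qed.

Lemma tip_dist_tri x y z : tip_dist x z <= tip_dist x y + tip_dist y z.
Proof.
rewrite /tip_dist -mulrDl ler_wpM2r//.
case: x y z => [[b l]|] [[b' l']|] [[b'' l'']|]; last by [].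
- have [->|ll'] := eqVneq l l'.
    by have [_|_] := eqVneq l' l''; move: b b' b'' => [] [] []/=; lra.
  have [<-|l'l''] := eqVneq l' l''.
    by rewrite (negPf ll'); move: b b' b'' => [] [] []/=; lra.
  by have [_|_] := eqVneq l l''; move: b b' b'' => [] [] []/=; lra.
- by have [_|_] := eqVneq l l'; move: b b' => [] []/=; lra.
- by have [_|_] := eqVneq l l''; move: b b'' => [] []/=; lra.
- by move: b => []; lra.
- by have [_|_] := eqVneq l' l''; move: b' b'' => [] []/=; lra.
- by move: b' => []; lra.
- by move: b'' => []; lra.
Qed.

Lemma tip_dist_lt1 x y : tip_dist x y < 1.
Proof.
rewrite /tip_dist; case: x y => [[b l]|] [[b' l']|]; last by lra.
- by have [_|_] := eqVneq l l'; move: b b' => [] []/=; lra.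
- by move: b => []; lra.
- by move: b' => []; lra.
Qed.

Definition tip_metric := SmallMetric R (star L) tip_dist tip_dist_refl
  tip_dist_gt0 tip_dist_sym tip_dist_tri tip_dist_lt1.

Section nested_metric.
Variables (a : R) (r : L -> R).
Hypotheses (a12 : 1 <= a <= 2) (r01 : forall l, 0 < r l < 2^-1).

Definition star_norm (x : star L) : R :=
  if x is Some (b, l) then if b then a * r l else r l else 0.

(** Points of different branches are at ultrametric distance, the larger of their distances to the
    centre. The bound [a <= 2] is the triangle inequality for the centre, a light point and its
    leaf. *)
Definition nested_dist (x y : star L) : R :=
  match x, y with
  | Some (b, l), Some (b', l') =>
      if l == l' then if b == b' then 0 else r l else Num.max (star_norm x) (star_norm y)
  | _, _ => star_norm x + star_norm y
  end.

Let r_gt0 l : 0 < r l. Proof. by have /andP[] := r01 l. Qed.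
Let r_lt l : r l < 2^-1. Proof. by have /andP[] := r01 l. Qed.
Let a_ge1 : 1 <= a. Proof. by have /andP[] := a12. Qed.
Let ar_ge l : r l <= a * r l. Proof. by rewrite ler_peMl// ltW. Qed.
Let ar_le l : a * r l <= 2 * r l.
Proof. by rewrite ler_wpM2r// ?(ltW (r_gt0 l))//; case/andP: a12. Qed.

Lemma star_norm_ge0 x : 0 <= star_norm x.
Proof.
case: x => [[[] l]|]//=; last exact: ltW.
by apply: le_trans (ar_ge l); exact: ltW.
Qed.

Lemma nested_dist_refl x : nested_dist x x = 0.
Proof. by case: x => [[b l]|] /=; rewrite ?eqxx// addr0. Qed.

Lemma nested_dist_gt0 x y : x != y -> 0 < nested_dist x y.
Proof.
have n0 b l : 0 < star_norm (Some (b, l)).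
  by case: b => //=; exact: lt_le_trans (ar_ge l).
case: x y => [[b l]|] [[b' k]|]//.
- rewrite /nested_dist; have [->|_ _] := eqVneq l k; last by rewrite lt_max n0.
  by have [->|//] := eqVneq b b'; rewrite eqxx.
- by move=> _; rewrite /nested_dist addr0.
- by move=> _; rewrite /nested_dist add0r.
Qed.

Lemma nested_dist_sym x y : nested_dist x y = nested_dist y x.
Proof.
case: x y => [[b l]|] [[b' k]|]; rewrite /nested_dist ?addr0 ?add0r//.
rewrite eq_sym [b == b']eq_sym maxC; by have [->|] := eqVneq k l.
Qed.

Lemma nested_dist_tri x y z : nested_dist x z <= nested_dist x y + nested_dist y z.
Proof.
have norm_None : star_norm None = 0 by [].
have maxl (u v : R) : u <= Num.max u v by rewrite le_max lexx.
have maxr (u v : R) : v <= Num.max u v by rewrite le_max lexx orbT.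
case: x y z => [[b l]|] [[b' l']|] [[b'' l'']|]; rewrite /nested_dist ?norm_None; last by lra.
- have [->|ll'] := eqVneq l l'.
    have [_|_] := eqVneq l' l''.
      by have := r_gt0 l'; move: b b' b'' => [] [] []/=; lra.
    have := maxl (star_norm (Some (b', l'))) (star_norm (Some (b'', l''))).
    have := maxr (star_norm (Some (b', l'))) (star_norm (Some (b'', l''))).
    rewrite ge_max; set t := Num.max _ _.
    have := r_gt0 l'; have := ar_ge l'; have := ar_le l'.
    by move: b b' b'' @t => [] [] [] /= t *; apply/andP; split; lra.
  have [<-|l'l''] := eqVneq l' l''.
    rewrite (negPf ll').
    have := maxl (star_norm (Some (b, l))) (star_norm (Some (b', l'))).
    have := maxr (star_norm (Some (b, l))) (star_norm (Some (b', l'))).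
    rewrite ge_max; set t := Num.max _ _.
    have := r_gt0 l'; have := ar_ge l'; have := ar_le l'.
    by move: b b' b'' @t => [] [] [] /= t *; apply/andP; split; lra.
  have := maxl (star_norm (Some (b, l))) (star_norm (Some (b', l'))).
  have := maxr (star_norm (Some (b, l))) (star_norm (Some (b', l'))).
  have := maxl (star_norm (Some (b', l'))) (star_norm (Some (b'', l''))).
  have := maxr (star_norm (Some (b', l'))) (star_norm (Some (b'', l''))).
  have := star_norm_ge0 (Some (b, l)).
  have := star_norm_ge0 (Some (b', l')).
  have := star_norm_ge0 (Some (b'', l'')).
  set t := Num.max (star_norm (Some (b, l))) (star_norm (Some (b', l'))).
  set u := Num.max (star_norm (Some (b', l'))) _.
  have [ll''|_] := eqVneq l l''.
    rewrite -ll''; have := r_gt0 l; have := ar_ge l; have := ar_le l.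
    by move: b b'' @t @u => [] [] /= t u *; lra.
  by move=> *; rewrite ge_max; apply/andP; split; lra.
- rewrite !addr0; have [->|ll'] := eqVneq l l'.
    have := r_gt0 l'; have := ar_ge l'; have := ar_le l'.
    by move: b b' => [] [] /= *; lra.
  have := maxl (star_norm (Some (b, l))) (star_norm (Some (b', l'))).
  by have := star_norm_ge0 (Some (b', l')); lra.
- rewrite addr0 add0r; have [->|ll''] := eqVneq l l''.
    have := r_gt0 l''; have := ar_ge l''; have := ar_le l''.
    by move: b b'' => [] [] /= *; lra.
  have := star_norm_ge0 (Some (b, l)); have := star_norm_ge0 (Some (b'', l'')).
  by move=> *; rewrite ge_max; apply/andP; split; lra.
- by rewrite addr0; lra.
- rewrite !add0r; have [->|ll'] := eqVneq l' l''.
    have := r_gt0 l''; have := ar_ge l''; have := ar_le l''.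
    by move: b' b'' => [] [] /= *; lra.
  have := maxr (star_norm (Some (b', l'))) (star_norm (Some (b'', l''))).
  by have := star_norm_ge0 (Some (b', l')); lra.
- by rewrite add0r addr0; have := star_norm_ge0 (Some (b', l')); lra.
- by rewrite add0r; lra.
Qed.

Lemma nested_dist_lt1 x y : nested_dist x y < 1.
Proof.
have n1 b l : star_norm (Some (b, l)) < 1.
  have := r_lt l; have := ar_le l; have := r_gt0 l.
  by case: b => /= *; lra.
case: x y => [[b l]|] [[b' k]|]; rewrite /nested_dist ?addr0 ?add0r//.
have [_|_] := eqVneq l k; last by rewrite gt_max !n1.
by case: eqP => _//; have := r_lt l; lra.
Qed.

Definition nested_metric := SmallMetric R (star L) nested_dist nested_dist_refl
  nested_dist_gt0 nested_dist_sym nested_dist_tri nested_dist_lt1.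

Lemma nested_metric_tip l z : z != star_tip l ->
  nested_metric (star_tip l) None <= nested_metric (star_tip l) z.
Proof.
case: z => [[b k]|]//= zl; rewrite /nested_dist addr0.
have [lk|_] := eqVneq l k; last by rewrite le_max lexx.
by case: b zl => //; rewrite lk /star_tip eqxx.
Qed.

End nested_metric.

Lemma equi_metric_tip l z : z != star_tip l ->
  equi_metric (star_tip l) None <= equi_metric (star_tip l) z.
Proof.
move=> zl; rewrite /= /equi_dist/= eq_sym (negPf zl).
by case: ifP => _; lra.
Qed.

Lemma equi_metric_leaves y k l l' : l != l' -> equi_metric y (star_leaf k) <=
  Num.max (equi_metric y (star_leaf l)) (equi_metric y (star_leaf l')).
Proof.
move=> ll'; rewrite le_max /= /equi_dist/=; case: y => [y|]/=; last by rewrite lexx.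
have [->|_] := eqVneq (Some y) (star_leaf l).
  rewrite [star_leaf l == star_leaf l'](inj_eq (@star_leaf_inj L)) (negPf ll') orbC/=.
  by case: ifP => _; lra.
by case: ifP => _; lra.
Qed.

Lemma tip_metric_tip l z : z != star_tip l ->
  tip_metric (star_tip l) None <= tip_metric (star_tip l) z.
Proof.
case: z => [[b k]|]//= zl; rewrite /tip_dist/=.
have [lk|_] := eqVneq l k; last by case: b {zl} => /=; lra.
by case: b zl => //=; rewrite lk /star_tip eqxx.
Qed.

Lemma tip_metric_leaves y k l l' : l != l' -> tip_metric y (star_leaf k) <=
  Num.max (tip_metric y (star_leaf l)) (tip_metric y (star_leaf l')).
Proof.
move=> ll'; rewrite le_max /= /tip_dist/=; case: y => [[b j]|]/=; last by rewrite lexx.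
have [->|_] := eqVneq j l.
  by rewrite (negPf ll') orbC; case: b; case: ifP => _ /=; lra.
by case: b; case: ifP => _ /=; lra.
Qed.

Lemma tip_metric_leaf l z k : ~~ is_leaf z -> z != star_tip l ->
  tip_metric (star_leaf l) (star_leaf k) <= tip_metric (star_leaf l) z.
Proof.
case: z => [[[] j]|]//= _ zl; rewrite /tip_dist/=; last by case: ifP => _; lra.
have [lj|_] := eqVneq l j; last by case: ifP => _; lra.
by move: zl; rewrite lj /star_tip eqxx.
Qed.

End star_metrics.

(** * Stars with prescribed behaviour *)

Section block_families.
Context {R : realType} (kappa : R) (kappa_ge1 : 1 <= kappa).

Let kappa_gt0 : 0 < kappa. Proof. exact: lt_le_trans kappa_ge1. Qed.

Lemma mass_le_leaves {L : finType} (w : L -> R) (w_ge1 : forall l, 1 <= w l)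
    (d : small_metric R (star L)) (A : pred (star L)) (P : pred L) :
  (forall l, A (star_leaf l) -> P l) ->
  mass (B := star_block w w_ge1 d) A <= 2 + \sum_(l | P l) w l.
Proof.
move=> AP; rewrite star_mass.
have : \sum_(l | A (star_leaf l)) w l <= \sum_(l | P l) w l.
  rewrite big_mkcond [leRHS]big_mkcond; apply: ler_sum => l _.
  case: ifP => [/AP->//|_]; case: ifP => // _; exact: le_trans (w_ge1 l).
have := sum_tips (R := R) (fun l => A (star_tip l)).
by case: (A None) => /=; lra.
Qed.

Section leaf_families.
Context {L : nat -> finType} {w : forall n, L n -> R} (w_ge1 : forall n l, 1 <= w n l).
Context {Qs Qw : set (\bar R)} (spec : leaf_spec L w Qs Qw).

Lemma family_spec_star (d : forall n, small_metric R (star (L n))) cent :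
  (forall n l z, z != star_tip l -> d n (star_tip l) None <= d n (star_tip l) z) ->
  (forall n y k l l', l != l' -> d n y (star_leaf k) <=
     Num.max (d n y (star_leaf l)) (d n y (star_leaf l'))) ->
  (forall n, reaches kappa (star_block (w n) (w_ge1 n) (d n)) cent None is_leaf) ->
  family_spec kappa (fun n => star_block (w n) (w_ge1 n) (d n)) cent Qs Qw.
Proof.
move=> tip_center leaves_far HR.
apply: (@family_spec_leaves R kappa kappa_ge1 L
  (fun n => star_block (w n) (w_ge1 n) (d n)) (fun n => @star_leaf (L n))
  (fun n => @is_leaf (L n)) (fun n => @star_leaf_inj (L n)) (fun n => @is_leafE (L n))
  w Qs Qw cent (fun n _ z => ~~ is_leaf z) (fun n => spread_kernel (w n)) 4) => //.
- by move=> n x _; exact: mass_core.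
- move=> n; apply: kernel_centered.
  by apply: spread_avg_kernel => //; [exact: tip_center|exact: leaves_far].
- by move=> n; exists None => //; exact: HR.
Qed.

Lemma family_spec_equi cent : kappa < 2 ->
  family_spec kappa (fun n => star_block (w n) (w_ge1 n) equi_metric) cent Qs Qw.
Proof.
move=> k2; apply: family_spec_star => [n|n|n [[[] l]|]//= _].
- exact: equi_metric_tip.
- exact: equi_metric_leaves.
(* More than the distance 1/4 to the centre since [kappa < 2]; the dilated radius is 1/2, and the
   open ball excludes the other leaves. *)
exists (star_leaf l), (2^-1 / kappa).
have kV : 4^-1 < 2^-1 / kappa by rewrite ltr_pdivlMr//; lra.
have kE : kappa * (2^-1 / kappa) = 2^-1 by field; rewrite gt_eqF.
split.
- by rewrite divr_gt0.
- by rewrite kE; lra.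
- by rewrite /relevant; case: cent; rewrite ?eqxx//= equi_dist_refl divr_gt0.
- by rewrite /bball/= /equi_dist/=.
- rewrite kE; apply: le_trans (mass_le_leaves _ _ _ _ (pred1 l) _) _ => [k|].
    rewrite /bball/= /equi_dist/= (inj_eq (@star_leaf_inj _)) eq_sym.
    by case: ifP => // _; rewrite ltxx.
  by rewrite big_pred1_eq /=; have := w_ge1 n l; lra.
Qed.

Lemma family_spec_tip : kappa < 3 ->
  family_spec kappa (fun n => star_block (w n) (w_ge1 n) tip_metric) false Qs Qw.
Proof.
move=> k3; apply: family_spec_star => [n|n|n [[[] l]|]//= _].
- exact: tip_metric_tip.
- exact: tip_metric_leaves.
(* More than 1/8 since [kappa < 3]; the dilated radius is 3/8, the excluded distance to the other
   leaves. *)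
exists (star_tip l), (3 / 8 / kappa).
have kV : 1 / 8 < 3 / 8 / kappa by rewrite ltr_pdivlMr//; lra.
have kE : kappa * (3 / 8 / kappa) = 3 / 8 by field; rewrite gt_eqF.
split.
- by apply: lt_trans kV; lra.
- by rewrite kE; lra.
- by rewrite /relevant/= /tip_dist/= eqxx.
- by rewrite /bball/= /tip_dist/=.
- rewrite kE; apply: le_trans (mass_le_leaves _ _ _ _ (pred1 l) _) _ => [k|].
    rewrite /bball/= /tip_dist/= eq_sym.
    by case: ifP => //= _; rewrite ltxx.
  by rewrite big_pred1_eq /=; have := w_ge1 n l; lra.
Qed.

Lemma family_spec_tip_centered :
  family_spec kappa (fun n => star_block (w n) (w_ge1 n) tip_metric) true
    [set p | (1 <= p)%E] [set p | (1 <= p)%E].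
Proof.
apply: (@family_spec_all R kappa kappa_ge1
  (fun n => star_block (w n) (w_ge1 n) tip_metric) true
  (fun n x z => spread_kernel (w n) x z + tip_kernel (w n) x z) 5) => n.
apply: spread_avg_kernel_centered => //.
- exact: tip_metric_tip.
- exact: tip_metric_leaves.
- exact: tip_metric_leaf.
Qed.

End leaf_families.

(** Blocks of three points are uniformly harmless for every exponent, while the unbounded leaf mass
    destroys doubling. *)
Definition pair_wt (n : nat) (l : unit) : R := n.+1%:R.

Lemma pair_wt_ge1 n l : 1 <= pair_wt n l. Proof. by rewrite ler1n. Qed.

Definition pair_block n : block R := star_block (pair_wt n) (pair_wt_ge1 n) equi_metric.

Lemma family_spec_pair cent :
  family_spec kappa pair_block cent [set p | (1 <= p)%E] [set p | (1 <= p)%E].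
Proof.
apply: (@family_spec_all R kappa kappa_ge1 pair_block cent (fun n x _ => (@wt R (pair_block n) x)^-1) 3) => n.
split.
- by move=> x _; rewrite invr_ge0 wt_ge0.
- move=> z; under eq_bigr do rewrite mulfV ?gt_eqF ?wt_gt0//.
  rewrite (sum_star (L := unit) (fun=> 1)) !sumr_const card_unit; lra.
- move=> x y s z s0 rel _ _.
  apply: (kernel_term (wt x)); [exact: wt_gt0| |by []].
  by apply/wt_le_mass/bball_dilate => //; exact: relevant_bball rel.
Qed.

Lemma pair_block_not_doubling (C : R) : exists n (a : pt (pair_block n)) s,
  [/\ 0 < s, 2 * s <= 1 & C * mass (bball a s) < mass (bball a (2 * s))].
Proof.
pose n := Num.truncn C; exists n.
have Cn : C < n.+1%:R :> R by exact: truncnS_gt.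
(* The open ball of radius 1/4 is the centre alone; twice the radius captures the leaf. *)
exists None, 4^-1; split; [by rewrite invr_gt0|by lra|].
have -> : mass (B := pair_block n) (bball (B := pair_block n) None 4^-1) = 1.
  apply: etrans (big_pred1 (None : star unit) _) _ => [x|//].
  rewrite /bball/= /equi_dist/= eq_sym; have [//|xN] := eqVneq x None.
    by move=> _; rewrite invr_gt0 ltr0n.
  by rewrite ltxx.
rewrite mulr1; apply: (lt_le_trans Cn).
apply: (@wt_le_mass _ (pair_block n) _ (star_leaf tt)).
by rewrite /bball/= /equi_dist/=; lra.
Qed.

(* Radii growing by the factor [theta], scaled so that all balls involved
   have radius at most [1]. *)
Definition nested_radius (theta : R) m (j : 'I_m) : R := theta ^+ j / (2 * theta ^+ m.+1).

Section nested_radius.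
Context (theta : R) (theta_ge2 : 2 <= theta) (m : nat).

Let theta_gt0 : 0 < theta. Proof. by apply: lt_le_trans theta_ge2. Qed.

Let theta_ge1 : 1 <= theta. Proof. by apply: le_trans theta_ge2; rewrite ler1n. Qed.

Lemma nested_radius_gt0 (j : 'I_m) : 0 < nested_radius theta m j.
Proof. by rewrite divr_gt0 ?mulr_gt0 ?exprn_gt0. Qed.

Lemma nested_radius_le (j : 'I_m) : 2 * (theta * nested_radius theta m j) <= 1.
Proof.
have -> : 2 * (theta * nested_radius theta m j) = theta ^+ j.+1 / theta ^+ m.+1.
  rewrite /nested_radius [theta ^+ j.+1]exprS; set t := theta ^+ m.+1.
  by field; rewrite gt_eqF// exprn_gt0.
by rewrite ler_pdivrMr ?exprn_gt0// mul1r ler_weXn2l// ltnS ltnW.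
Qed.

Lemma nested_radius_lt (j : 'I_m) : 0 < nested_radius theta m j < 2^-1.
Proof.
rewrite nested_radius_gt0/=; have := nested_radius_le j; have := nested_radius_gt0 j.
set r := nested_radius _ _ _ => r0; have : 2 * r <= theta * r by rewrite ler_wpM2r// ltW.
by lra.
Qed.

Lemma nested_radiusS (i j : 'I_m) : j = i.+1 :> nat ->
  nested_radius theta m j = theta * nested_radius theta m i.
Proof. by move=> ji; rewrite /nested_radius ji exprS mulrA. Qed.

Lemma nested_radius_gap (i j : 'I_m) : (i < j)%N ->
  theta * nested_radius theta m i <= nested_radius theta m j.
Proof.
move=> ij; rewrite /nested_radius mulrA -exprS ler_wpM2r ?invr_ge0 ?mulr_ge0 ?exprn_ge0 ?(ltW theta_gt0)//.
by rewrite ler_weXn2l.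
Qed.

End nested_radius.

Lemma mass_le_nested m (d : small_metric R (star 'I_m)) (A : pred (star 'I_m)) (j : 'I_m) :
  (forall i, A (star_leaf i) -> (i <= j)%N) ->
  mass (B := star_block (fun i : 'I_m => nested_wt i) (fun i => nested_wt_ge1 i) d) A
  <= 4 * nested_wt j.
Proof.
move=> Aj; apply: le_trans (mass_le_leaves _ _ _ _ (fun i : 'I_m => i < j.+1)%N _) _ => //.
rewrite -(big_ord_widen m nested_wt (ltn_ord j)).
by have := sum_nested_wt (R := R) j; have := nested_wt_ge1 (R := R) j; lra.
Qed.

Lemma reaches_centered B cent (c : pt B) P :
  reaches kappa B true c P -> reaches kappa B cent c P.
Proof.
case: cent => // H x Px; have [y [s [s0 ks /eqP yx yc yM]]] := H x Px.
by exists y, s; split => //; rewrite yx /relevant dist_refl.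
Qed.

Let theta_ge2 : 2 <= 2 * kappa. Proof. by rewrite ler_peMr. Qed.

Let one_le2 : 1 <= (1 : R) <= 2. Proof. by rewrite lexx ler1n. Qed.

(** With ratio [2 * kappa] the ball of radius [2 * r j] around leaf [j] reaches the centre, and its
    dilation stops just short of leaf [j + 1]. *)
Definition chain_metric m := nested_metric 1 (nested_radius (2 * kappa) m) one_le2
  (nested_radius_lt (2 * kappa) theta_ge2 m).

Lemma family_spec_chain cent :
  family_spec kappa (nested_block chain_metric) cent [set p | (1 < p)%E] [set p | (1 <= p)%E].
Proof.
apply: family_spec_nested => // m; first exact: nested_metric_tip.
apply: reaches_centered => -[[[] j]|]//= _.
set r := nested_radius (2 * kappa) m.
have r0 : 0 < r j by exact: nested_radius_gt0.
exists (star_leaf j), (2 * r j); split.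
- by rewrite mulr_gt0.
- have := nested_radius_le (2 * kappa) theta_ge2 m j; rewrite -/r => H.
  by have : 0 <= kappa * r j; [rewrite mulr_ge0// ltW|lra].
- by rewrite /relevant eqxx.
- by rewrite /bball/= /nested_dist/= addr0 mul1r ltr_pMl// ltr1n.
- apply: mass_le_nested => i; rewrite /bball/= /nested_dist/= !mul1r eq_sym.
  have [->//|_] := eqVneq i j; rewrite gt_max => /andP[_ ri].
  rewrite leqNgt; apply/negP => /(nested_radius_gap (2 * kappa) theta_ge2 m); rewrite -/r.
  have E : kappa * (2 * r j) = 2 * kappa * r j by ring.
  have {}ri : r i < kappa * (2 * r j) := ri.
  move=> ij; have := nested_radius_gt0 (2 * kappa) theta_ge2 m i; rewrite -/r; lra.
Qed.

Section kappa_ge2.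
Hypothesis kappa_ge2 : 2 <= kappa.

Let two_le2 : 1 <= (2 : R) <= 2. Proof. by rewrite lexx ler1n. Qed.

(** Each light point is halfway between the centre and its leaf. Its ball of radius [2 * r j]
    contains both, and the dilation stops just short of the next leaf, at distance
    [2 * r (j + 1)]. *)
Definition bridge_metric m := nested_metric 2 (nested_radius kappa m) two_le2
  (nested_radius_lt kappa kappa_ge2 m).

Lemma family_spec_bridge :
  family_spec kappa (nested_block bridge_metric) false [set p | (1 < p)%E] [set p | (1 <= p)%E].
Proof.
apply: family_spec_nested => // m; first exact: nested_metric_tip.
move=> [[[] j]|]//= _.
set r := nested_radius kappa m.
have r0 : 0 < r j by exact: nested_radius_gt0.
exists (star_tip j), (2 * r j); split.
- by rewrite mulr_gt0.
- by rewrite mulrCA; exact: nested_radius_le.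
- by rewrite /relevant/= /nested_dist/= eqxx ltr_pMl// ltr1n.
- by rewrite /bball/= /nested_dist/= addr0 ltr_pMl// ltr1n.
- apply: mass_le_nested => i; rewrite /bball/= /nested_dist/= eq_sym.
  have [->//|_] := eqVneq i j; rewrite gt_max => /andP[_ ri].
  rewrite leqNgt; apply/negP => /(nested_radius_gap kappa kappa_ge2 m); rewrite -/r.
  have E : kappa * (2 * r j) = 2 * (kappa * r j) by ring.
  have {}ri : 2 * r i < kappa * (2 * r j) := ri.
  move=> ij; have := nested_radius_gt0 kappa kappa_ge2 m i; rewrite -/r; lra.
Qed.

(** From leaf [i], anything but its own light point is at distance at least [2 * r i], and leaf
    [i + 1] is at distance [kappa * (2 * r i)]. *)
Lemma family_spec_bridge_centered : family_spec kappa (nested_block bridge_metric) true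
  [set p | (1 <= p)%E] [set p | (1 <= p)%E].
Proof.
apply: (@family_spec_all R kappa kappa_ge1 (nested_block bridge_metric) true
  (fun m => next_kernel m) 7) => m.
apply: (next_avg_kernel m (bridge_metric m) _ kappa kappa_ge1); first exact: nested_metric_tip.
move=> i j z ji zi zt; have rj := nested_radiusS kappa m i j ji.
have r0 : 0 < nested_radius kappa m i by exact: nested_radius_gt0.
have rij : nested_radius kappa m i <= nested_radius kappa m j.
  by rewrite rj ler_peMl// ltW.
apply: (@le_trans _ _ (kappa * (2 * nested_radius kappa m i))).
  rewrite /= /nested_dist/=; case: ifP => _.
    by rewrite mulr_ge0 ?(ltW kappa_gt0)// mulr_ge0 ?ler0n ?(ltW r0).
  by rewrite ge_max rj; apply/andP; split; move: rij; rewrite rj; lra.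
rewrite ler_wpM2l ?(ltW kappa_gt0)//= /nested_dist/=.
case: z zi zt => [[b k]|] zi zt; last by rewrite addr0.
have [ik|_] := eqVneq i k; last by rewrite le_max lexx.
by case: b zi zt => [/eqP []|_ /eqP []]; rewrite ik.
Qed.

End kappa_ge2.

End block_families.

(** * Leaf weights with prescribed exponents *)

Section leaf_weights.
Context {R : realType}.
Implicit Types p : R.

Lemma lt_powR2 (x : R) : x < 2 `^ x.
Proof.
have [x0|x0] := ltP x 0; first exact: lt_le_trans x0 (powR_ge0 _ _).
have /andP[_ xn] := truncn_itv x0.
set n := Num.truncn x in xn *.
have [x1|x1] := ltP x 1.
  by apply: (lt_le_trans x1); rewrite -[X in X <= _](powRr0 2) ler_powR// ler1n.
apply: (lt_le_trans xn); apply: (@le_trans _ _ (2 `^ n%:R)); last first.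
  by rewrite ler_powR ?ler1n// /n truncn_le.
by rewrite powR_mulrn// -natrX ler_nat ltn_expl.
Qed.

Definition num_leaves (x : R) : nat := (Num.truncn x).+1.

Lemma num_leaves_ge x : x <= (num_leaves x)%:R.
Proof. exact/ltW/truncnS_gt. Qed.

Lemma num_leaves_le x : 1 <= x -> (num_leaves x)%:R <= 2 * x.
Proof.
move=> x1; have x0 : 0 <= x by apply: le_trans x1.
by have := truncn_itv x0 => /andP[+ _]; rewrite /num_leaves -natr1; lra.
Qed.

(** If [w < t], then [w <= t ^ p * w ^ (1 - p)]. *)
Lemma weak_of_strong (L : finType) (w : L -> R) p C t : 1 <= p -> 0 < t ->
  (forall l, 1 <= w l) -> \sum_l w l `^ (1 - p) <= C ->
  \sum_(l | w l < t) w l <= C * t `^ p.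
Proof.
move=> p1 t0 w1 CP; rewrite mulrC.
apply: (@le_trans _ _ (t `^ p * \sum_l w l `^ (1 - p))); last by rewrite ler_wpM2l ?powR_ge0.
rewrite mulr_sumr big_mkcond; apply: ler_sum => l _.
case: ifPn => [lt|_]; last by rewrite mulr_ge0 ?powR_ge0.
have w0 : 0 < w l by apply: lt_le_trans (w1 l).
rewrite -mul_powRN// mulrCA ler_peMr ?(ltW w0)//.
rewrite ler_pdivlMr ?powR_gt0// mul1r ge0_ler_powR ?nnegrE ?(ltW w0) ?(ltW t0) ?(ltW lt)//.
exact: le_trans p1.
Qed.

(** * Blocks whose leaves all have the same mass *)

Section single_level.
Variable alpha : nat -> R.
Hypothesis alpha_ge0 : forall n, 0 <= alpha n.

(** Up to a bounded error, the base 2 logarithm of the strong sum for about [2 ^ alpha n] leaves of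
    mass [2 ^ (n * n)]. *)
Definition level_exponent p n := alpha n + (n * n)%:R * (1 - p).

Definition level_leaves n : finType := 'I_(num_leaves (2 `^ alpha n)).

Lemma sum_level n (x : R) : \sum_(l : level_leaves n) x = (num_leaves (2 `^ alpha n))%:R * x.
Proof. by rewrite sumr_const card_ord mulr_natl. Qed.

Lemma nested_wtE n : nested_wt n = 2 `^ (n * n)%:R :> R.
Proof. by rewrite powR_mulrn. Qed.

Lemma level_sum p n : (num_leaves (2 `^ alpha n))%:R * nested_wt n `^ (1 - p)
  = (num_leaves (2 `^ alpha n))%:R / 2 `^ alpha n * 2 `^ level_exponent p n.
Proof.
rewrite /level_exponent powRD; last by rewrite pnatr_eq0 implybT.
rewrite nested_wtE -powRrM; field.
by rewrite gt_eqF// powR_gt0.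
Qed.

Lemma level_sum_ge p n :
  2 `^ level_exponent p n <= (num_leaves (2 `^ alpha n))%:R * nested_wt n `^ (1 - p).
Proof.
rewrite level_sum ler_peMl ?powR_ge0// ler_pdivlMr ?powR_gt0// mul1r.
exact: num_leaves_ge.
Qed.

Lemma level_sum_le p n :
  (num_leaves (2 `^ alpha n))%:R * nested_wt n `^ (1 - p) <= 2 * 2 `^ level_exponent p n.
Proof.
rewrite level_sum ler_wpM2r ?powR_ge0// ler_pdivrMr ?powR_gt0//.
by apply: num_leaves_le; rewrite -[X in X <= _](powRr0 2) ler_powR// ler1n.
Qed.

(** With one mass per block both conditions agree: the weak one fails at [t] equal to that mass. *)
Lemma leaf_spec_level (Q : set (\bar R)) :
  (forall p, 1 <= p -> Q p%:E -> exists b, forall n, level_exponent p n <= b) ->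
  (forall p, 1 <= p -> ~ Q p%:E -> forall b, exists n, b < level_exponent p n) ->
  leaf_spec level_leaves (fun n _ => nested_wt n) Q Q.
Proof.
move=> Qb nQ p p1.
have strong : Q p%:E -> exists C, forall n,
    \sum_(l : level_leaves n) nested_wt n `^ (1 - p) <= C.
  move=> /(Qb p p1)[b bP]; exists (2 * 2 `^ b) => n.
  rewrite sum_level.
  by apply: (le_trans (level_sum_le p n)); rewrite ler_wpM2l// ler_powR ?ler1n.
have fails : ~ Q p%:E -> forall C, exists n,
    C < (num_leaves (2 `^ alpha n))%:R * nested_wt n `^ (1 - p).
  move=> /(nQ p p1) nb C; have [n Cn] := nb C; exists n.
  apply: lt_le_trans (level_sum_ge p n).
  by apply: (lt_le_trans (lt_powR2 C)); rewrite ler_powR ?ler1n// ltW.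
split => //.
- move=> /fails F C; have [n Cn] := F C; exists n.
  by rewrite sum_level.
- move=> /strong[C CP]; exists C => n t t0.
  by apply: weak_of_strong => // l; exact: nested_wt_ge1.
- move=> /fails F C; have [n Cn] := F C; exists n, (nested_wt n).
  split; first exact: nested_wt_gt0.
  rewrite (eq_bigl xpredT); last by move=> l; rewrite lexx.
  rewrite sum_level.
  by move: Cn; rewrite -mul_powRN ?nested_wt_gt0// mulrA ltr_pdivlMr ?powR_gt0 ?nested_wt_gt0.
Qed.

End single_level.

Lemma leaf_spec_closed (p0 : R) : 1 <= p0 -> exists (L : nat -> finType) (w : forall n, L n -> R),
  (forall n l, 1 <= w n l) /\
  leaf_spec L w [set p | (p0%:E <= p)%E] [set p | (p0%:E <= p)%E].
Proof.
move=> p01; pose alpha n := (n * n)%:R * (p0 - 1) : R.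
have alpha0 n : 0 <= alpha n by rewrite mulr_ge0// subr_ge0.
have E p n : level_exponent alpha p n = (n * n)%:R * (p0 - p).
  by rewrite /level_exponent /alpha; ring.
exists (level_leaves alpha), (fun n _ => nested_wt n); split => [n l|]; first exact: nested_wt_ge1.
apply: leaf_spec_level => // p p1 /=; rewrite lee_fin.
  by move=> pp; exists 0 => n; rewrite E mulr_ge0_le0// subr_le0.
move=> /negP; rewrite -ltNge => pp b.
have e0 : 0 < p0 - p by rewrite subr_gt0.
exists (num_leaves (b / (p0 - p))); rewrite E -ltr_pdivrMr//.
apply: (@lt_le_trans _ _ (num_leaves (b / (p0 - p)))%:R); first exact: truncnS_gt.
by rewrite ler_nat leq_pmull.
Qed.

Lemma leaf_spec_open (p0 : R) : 1 <= p0 -> exists (L : nat -> finType) (w : forall n, L n -> R),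
  (forall n l, 1 <= w n l) /\
  leaf_spec L w [set p | (p0%:E < p)%E] [set p | (p0%:E < p)%E].
Proof.
(* The extra [n] makes the exponent unbounded at [p = p0], but the quadratic term absorbs it for
   [p > p0]. *)
move=> p01; pose alpha n := (n * n)%:R * (p0 - 1) + n%:R : R.
have alpha0 n : 0 <= alpha n by rewrite addr_ge0// mulr_ge0// subr_ge0.
have E p n : level_exponent alpha p n = (n * n)%:R * (p0 - p) + n%:R.
  by rewrite /level_exponent /alpha; ring.
exists (level_leaves alpha), (fun n _ => nested_wt n); split => [n l|]; first exact: nested_wt_ge1.
apply: leaf_spec_level => // p p1 /=; rewrite lte_fin.
  move=> pp; have e0 : 0 < p - p0 by rewrite subr_gt0.
  exists (p - p0)^-1 => n; rewrite E natrM.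
  have -> : n%:R * n%:R * (p0 - p) + n%:R = n%:R * (1 - n%:R * (p - p0)) :> R by ring.
  have [ne|ne] := leP 1 (n%:R * (p - p0)).
    by apply: (@le_trans _ _ 0); rewrite ?invr_ge0 ?(ltW e0)// mulr_ge0_le0// subr_le0.
  apply: (@le_trans _ _ n%:R); first by rewrite ler_piMr// gerBl mulr_ge0// ltW.
  by rewrite -[leRHS]mul1r ler_pdivlMr// ltW.
move=> /negP; rewrite -leNgt => pp b.
exists (num_leaves b); rewrite E; apply: (@lt_le_trans _ _ (num_leaves b)%:R); first exact: truncnS_gt.
by rewrite lerDr mulr_ge0// subr_ge0.
Qed.

Lemma leaf_spec_oo : exists (L : nat -> finType) (w : forall n, L n -> R),
  (forall n l, 1 <= w n l) /\ leaf_spec L w [set +oo%E] [set +oo%E].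
Proof.
(* The cube outgrows [n * n * (p - 1)] for every finite [p]. *)
pose alpha n := (n * n * n)%:R : R.
exists (level_leaves alpha), (fun n _ => nested_wt n); split => [n l|]; first exact: nested_wt_ge1.
apply: leaf_spec_level => [n|p p1 /=|p p1 _ b]; [by []|by []|].
exists (maxn (num_leaves b) (num_leaves p)); set n := maxn _ _.
have -> : level_exponent alpha p n = (n * n)%:R * (n%:R - p + 1).
  by rewrite /level_exponent /alpha !natrM; ring.
have bn : b < n%:R by apply: (lt_le_trans (truncnS_gt b)); rewrite ler_nat leq_maxl.
have pn : p <= n%:R by apply: (le_trans (num_leaves_ge p)); rewrite ler_nat leq_maxr.
apply: (lt_le_trans bn); apply: (@le_trans _ _ (n * n)%:R).
  by rewrite ler_nat leq_pmull// leq_max.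
by rewrite ler_peMr// lerDr subr_ge0.
Qed.

(** * Blocks with geometrically growing leaf masses *)

Section multi_level.
Variable p0 : R.
Hypothesis p01 : 1 <= p0.

(** At [p = p0] every level contributes about 1 to the strong sum, which therefore diverges, while
    the weak condition survives. *)
Definition tower_leaves n : finType := {j : 'I_n & 'I_(num_leaves (2 `^ (j%:R * (p0 - 1))))}.

Definition tower_wt n (l : tower_leaves n) : R := 2 ^+ (tag l).

Lemma sum_tower n (F : nat -> R) (P : pred nat) :
  \sum_(l : tower_leaves n | P (tag l)) F (tag l) =
  \sum_(j < n | P j) (num_leaves (2 `^ (j%:R * (p0 - 1))))%:R * F j.
Proof.
rewrite (eq_bigl (fun l : tower_leaves n => P (tag l) && true)); last first.
  by move=> l; rewrite andbT.
rewrite -(sig_big_dep (fun j : 'I_n => P j) (fun _ _ => true) (fun (j : 'I_n) _ => F j)).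
apply: eq_bigr => j _; transitivity (\sum_(k < num_leaves (2 `^ (j%:R * (p0 - 1)))) F j) => //.
by rewrite sumr_const card_ord -[LHS]mulr_natl.
Qed.

Lemma tower_term p (j : nat) :
  2 `^ (j%:R * (p0 - 1)) * (2 ^+ j) `^ (1 - p) = (2 `^ (p0 - p)) ^+ j :> R.
Proof.
rewrite -!powR_mulrn ?powR_ge0// -!powRrM -powRD; last by rewrite pnatr_eq0 implybT.
by congr (_ `^ _); ring.
Qed.

Lemma tower_term_ge p (j : nat) : (2 `^ (p0 - p)) ^+ j <=
  (num_leaves (2 `^ (j%:R * (p0 - 1))))%:R * (2 ^+ j) `^ (1 - p).
Proof. by rewrite -tower_term ler_wpM2r ?powR_ge0// num_leaves_ge. Qed.

Lemma tower_term_le p (j : nat) :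
  (num_leaves (2 `^ (j%:R * (p0 - 1))))%:R * (2 ^+ j) `^ (1 - p) <= 2 * (2 `^ (p0 - p)) ^+ j.
Proof.
rewrite -tower_term mulrA ler_wpM2r ?powR_ge0// num_leaves_le//.
by rewrite -[X in X <= _](powRr0 2) ler_powR ?ler1n// mulr_ge0// subr_ge0.
Qed.

Lemma sum_tower_strong p n : \sum_(l : tower_leaves n) tower_wt n l `^ (1 - p) =
  \sum_(j < n) (num_leaves (2 `^ (j%:R * (p0 - 1))))%:R * (2 ^+ j) `^ (1 - p).
Proof. exact: (sum_tower n (fun j => (2 ^+ j) `^ (1 - p)) xpredT). Qed.

(* At the critical exponent the terms form a geometric progression of
   ratio at least [2], so the sum is controlled by its last term. *)
Lemma tower_weak n t : 0 < t ->
  \sum_(l : tower_leaves n | tower_wt n l < t) tower_wt n l <= 4 * t `^ p0.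
Proof.
move=> t0; rewrite (sum_tower n (fun j => 2 ^+ j) (fun j => 2 ^+ j < t)).
pose u j := (num_leaves (2 `^ (j%:R * (p0 - 1))))%:R * 2 ^+ j : R.
have u0 j : 0 <= u j by rewrite mulr_ge0// exprn_ge0.
have p00 : 0 <= p0 by apply: le_trans p01.
have uE j : 2 `^ (j%:R * (p0 - 1)) * 2 ^+ j = (2 ^+ j) `^ p0 :> R.
  rewrite -!powR_mulrn// -!powRrM -powRD; last by rewrite pnatr_eq0 implybT.
  by congr (_ `^ _); ring.
have ule j : u j <= 2 * (2 ^+ j) `^ p0.
  rewrite -uE mulrA ler_wpM2r ?exprn_ge0// num_leaves_le//.
  by rewrite -[X in X <= _](powRr0 2) ler_powR ?ler1n// mulr_ge0// subr_ge0.
have geo j : \sum_(i < j.+1) (2 ^+ i) `^ p0 <= 2 * (2 ^+ j) `^ p0 :> R.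
  elim: j => [|j IH]; first by rewrite big_ord1 ler_peMl ?powR_ge0 ?ler1n.
  rewrite big_ord_recr/= mulr2n mulrDl mul1r lerD2r; apply: (le_trans IH).
  rewrite exprS powRM ?exprn_ge0// ler_wpM2r ?powR_ge0//.
  by rewrite -[X in X <= _]powRr1// ler_powR ?ler1n.
elim: n => [|n IH]; first by rewrite big_ord0 mulr_ge0// powR_ge0.
have [nt|nt] := ltP (2 ^+ n) t; last first.
  by rewrite big_mkcond big_ord_recr/= ltNge nt addr0 -big_mkcond.
apply: (@le_trans _ _ (\sum_(j < n.+1) 2 * (2 ^+ j) `^ p0)).
  rewrite big_mkcond; apply: ler_sum => j _; case: ifP => _; first exact: ule.
  by rewrite mulr_ge0// powR_ge0.
rewrite -mulr_sumr (_ : 4 = 2 * 2 :> R); last by ring.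
rewrite -mulrA ler_wpM2l//; apply: (le_trans (geo n)); rewrite ler_wpM2l//.
by rewrite ge0_ler_powR ?nnegrE ?exprn_ge0 ?(ltW t0) ?(ltW nt).
Qed.

Lemma leaf_spec_tower :
  leaf_spec tower_leaves tower_wt [set p | (p0%:E < p)%E] [set p | (p0%:E <= p)%E].
Proof.
move=> p p1.
have w1 n l : 1 <= tower_wt n l by rewrite exprn_ege1// ler1n.
have strong : p0 < p -> exists C, forall n, \sum_l tower_wt n l `^ (1 - p) <= C.
  move=> pp; pose q : R := 2 `^ (p0 - p); exists (2 * (1 - q)^-1) => n.
  have q01 : 0 <= q < 1.
    rewrite powR_ge0/= /q (_ : p0 - p = - (p - p0)); last by rewrite opprB.
    rewrite powRN invf_lt1 ?powR_gt0//.
    have : 1 `^ (p - p0) < 2 `^ (p - p0) :> R.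
      by apply: gt0_ltr_powR; rewrite ?subr_gt0 ?nnegrE ?ltr1n.
    by rewrite powR1.
  rewrite sum_tower_strong; apply: (@le_trans _ _ (\sum_(j < n) 2 * q ^+ j)).
    by apply: ler_sum => j _; exact: tower_term_le.
  by rewrite -mulr_sumr ler_wpM2l// sum_geometric_le.
split => /=.
- by rewrite lte_fin.
- rewrite lte_fin => /negP; rewrite -leNgt => pp C; exists (num_leaves C).
  apply: (@lt_le_trans _ _ (num_leaves C)%:R); first exact: truncnS_gt.
  rewrite sum_tower_strong -[in leLHS](card_ord (num_leaves C)) -sumr_const.
  apply: ler_sum => j _; apply: le_trans (tower_term_ge p j).
  by rewrite exprn_ege1// -[X in X <= _](powRr0 2) ler_powR ?ler1n// subr_ge0.
- rewrite lee_fin le_eqVlt => /orP[/eqP <-|/strong[C CP]].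
    by exists 4 => n t; exact: tower_weak.
  exists C => n t t0; apply: weak_of_strong => //; exact: CP.
- rewrite lee_fin => /negP; rewrite -ltNge => pp C.
  have e0 : 0 < p0 - p by rewrite subr_gt0.
  (* At [t = 2 ^ j] level [j] alone has mass at least [t ^ p * 2 ^ (j * (p0 - p))], and the choice
     of [j] makes the last factor exceed [C]. *)
  pose j := num_leaves (C / (p0 - p)); exists j.+1, (2 ^+ j); split; first by rewrite exprn_gt0.
  rewrite (sum_tower j.+1 (fun i => 2 ^+ i) (fun i => 2 ^+ i <= 2 ^+ j)).
  rewrite (bigD1 ord_max)//=; apply: (@lt_le_trans _ _
    ((num_leaves (2 `^ (j%:R * (p0 - 1))))%:R * 2 ^+ j)); last first.
    by rewrite lerDl; apply: sumr_ge0 => i _; rewrite mulr_ge0// exprn_ge0.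
  rewrite -ltr_pdivlMr ?powR_gt0 ?exprn_gt0// -mulrA mul_powRN ?exprn_gt0//.
  apply: lt_le_trans (tower_term_ge p j).
  rewrite -powR_mulrn ?powR_ge0// -powRrM.
  apply: (lt_le_trans (lt_powR2 C)); rewrite ler_powR ?ler1n// mulrC -ler_pdivrMr//.
  exact: num_leaves_ge.
Qed.

End multi_level.

Lemma closure_le (P Q : set (\bar R)) x : P `<=` closure Q -> Q `<=` [set p | (x <= p)%E] ->
  P `<=` [set p | (x <= p)%E].
Proof.
move=> PQ Qx; apply: (subset_trans PQ).
have /closure_id -> : closed [set p | (x <= p)%E] by exact: closed_ereal_le_ereal.
exact: closureS.
Qed.

(** The closure condition lets [Pw] differ from [Ps] only by the endpoint of an open half-line; this
    case is realized by towers. *)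
Lemma leaf_spec_exists (Ps Pw : set (\bar R)) : admissible_exponent_set Ps ->
  Ps `<=` Pw -> Pw `<=` closure Ps ->
  exists (L : nat -> finType) (w : forall n, L n -> R),
    (forall n l, 1 <= w n l) /\ leaf_spec L w Ps Pw.
Proof.
move=> [->|[p0 [p01 [->|->]]]] sw wc.
- have -> : Pw = [set +oo%E]; last exact: leaf_spec_oo.
  apply/seteqP; split => // p /(closure_le _ _ +oo%E wc) H.
  by apply/eqP; rewrite -leye_eq; apply: H => _ ->.
- have -> : Pw = [set p | (p0%:E <= p)%E]; last exact: leaf_spec_closed.
  by apply/seteqP; split => //; exact: closure_le wc _.
have Pwp0 : Pw `<=` [set p | (p0%:E <= p)%E].
  by apply: (closure_le _ _ _ wc) => p /= /ltW.
have [p0w|p0w] := pselect (Pw p0%:E); last first.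
  have -> : Pw = [set p | (p0%:E < p)%E]; last exact: leaf_spec_open.
  apply/seteqP; split => // p Pp /=; rewrite lt_neqAle Pwp0// andbT.
  by apply: contra_notN p0w => /eqP ->.
have -> : Pw = [set p | (p0%:E <= p)%E].
  apply/seteqP; split => // p /=; rewrite le_eqVlt => /orP[/eqP <-//|]; exact: sw.
exists (tower_leaves p0), (tower_wt p0); split; last exact: leaf_spec_tower.
by move=> n l; rewrite exprn_ege1// ler1n.
Qed.

End leaf_weights.

(** * Assembly *)

Section assembly.
Context {R : realType} (kappa : R) (kappa_ge1 : 1 <= kappa).
Implicit Types P Q : set (\bar R).

Local Notation all_exponents := [set p : \bar R | (1 <= p)%E].

Lemma admissible_oo P : admissible_exponent_set P -> P +oo%E.
Proof. by move=> [->//|[p0 [_ [->|->]]]] /=; rewrite ?leey ?ltry. Qed.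

(** A closed half-line containing [P] contains its closure, hence 1. *)
Lemma admissible_dense P : admissible_exponent_set P -> all_exponents `<=` closure P ->
  P = all_exponents \/ P = [set p | (1 < p)%E].
Proof.
move=> [->|[p0 [p01 [->|->]]]] dense.
- have oo : [set +oo%E] `<=` [set p : \bar R | (+oo <= p)%E] by move=> _ ->; exact: lexx.
  by have := closure_le _ _ _ dense oo 1%E (lexx _).
- have := closure_le _ _ p0%:E dense (@subset_refl _ _) 1%E (lexx _).
  by rewrite /= lee_fin => p10; left; rewrite (@le_anti _ _ p0 1) ?p10.
- have lt : [set p | (p0%:E < p)%E] `<=` [set p | (p0%:E <= p)%E] by move=> p /= /ltW.
  have := closure_le _ _ _ dense lt 1%E (lexx _).
  by rewrite /= lee_fin => p10; right; rewrite (@le_anti _ _ p0 1) ?p10.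
Qed.

Lemma family_spec_ext Bk cent Qs Qw Qs' Qw' :
  (forall p, (1 <= p)%E -> Qs p <-> Qs' p) -> (forall p, (1 <= p)%E -> Qw p <-> Qw' p) ->
  family_spec kappa Bk cent Qs Qw -> family_spec kappa Bk cent Qs' Qw'.
Proof.
move=> es ew spec p p1; have [a b c d] := spec p p1.
have Es : Qs' p%:E <-> Qs p%:E by split=> /es; apply; rewrite lee_fin.
have Ew : Qw' p%:E <-> Qw p%:E by split=> /ew; apply; rewrite lee_fin.
split.
- by move=> /Es/a.
- by move=> nQ; apply: b => /Es.
- by move=> /Ew/c.
- by move=> nQ; apply: d => /Ew.
Qed.

(** Both operators have the same good exponents here, which costs the noncentred one nothing because
    its prescribed sets are smaller. *)
Lemma centered_family (Pcs Pcw : set (\bar R)) : admissible_exponent_set Pcs ->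
  Pcs `<=` Pcw -> Pcw `<=` closure Pcs -> (2 <= kappa -> Pcw = all_exponents) ->
  exists Bk, forall cent, family_spec kappa Bk cent Pcs Pcw.
Proof.
move=> aP sw wc P2; have [k2|k2] := ltP kappa 2.
  have [L [w [w1 spec]]] := leaf_spec_exists _ _ aP sw wc.
  by exists (fun n => star_block (w n) (w1 n) equi_metric) => cent; exact: family_spec_equi.
move: wc; rewrite P2// => /(admissible_dense _ aP)[->|->].
  by exists (pair_block) => cent; exact: family_spec_pair.
by exists (nested_block (chain_metric kappa kappa_ge1)) => cent; exact: family_spec_chain.
Qed.

Lemma noncentered_family (Ps Pw : set (\bar R)) : admissible_exponent_set Ps ->
  Ps `<=` Pw -> Pw `<=` closure Ps -> (3 <= kappa -> Pw = all_exponents) ->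
  exists Bk, family_spec kappa Bk true all_exponents all_exponents /\
             family_spec kappa Bk false Ps Pw.
Proof.
move=> aP sw wc P3; have [k3|k3] := ltP kappa 3.
  have [L [w [w1 spec]]] := leaf_spec_exists _ _ aP sw wc.
  exists (fun n => star_block (w n) (w1 n) tip_metric); split.
    exact: family_spec_tip_centered.
  exact: family_spec_tip.
have k2 : 2 <= kappa by apply: le_trans k3; rewrite ler_nat.
move: wc; rewrite P3// => /(admissible_dense _ aP)[->|->].
  by exists pair_block; split; exact: family_spec_pair.
exists (nested_block (bridge_metric kappa k2)); split.
  exact: family_spec_bridge_centered.
exact: family_spec_bridge.
Qed.

End assembly.

Theorem theorem3p2p2 (R : realType) (kappa : R)
    (Pcs Pcw Ps Pw : set (\bar R)) :
  1 <= kappa ->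
  admissible_exponent_set Pcs -> admissible_exponent_set Pcw ->
  admissible_exponent_set Ps -> admissible_exponent_set Pw ->
  Ps `<=` Pcs -> Pw `<=` Pcw ->
  Pcs `<=` Pcw -> Pcw `<=` closure Pcs ->
  Ps `<=` Pw -> Pw `<=` closure Ps ->
  (2 <= kappa -> Pcw = [set p | (1 <= p)%E]) ->
  (3 <= kappa -> Pw = [set p | (1 <= p)%E]) ->
  exists (d : measure_display) (X : measurableType d)
         (mu : {measure set X -> \bar R}) (rho : X -> X -> R),
    [/\ metric_measure_space rho mu,
        ~ doubling rho mu &
        forall p : \bar R, (1 <= p)%E ->
          [/\ strong_type mu (Mc rho mu kappa) p <-> Pcs p,
              weak_type mu (Mc rho mu kappa) p <-> Pcw p,
              strong_type mu (Mnc rho mu kappa) p <-> Ps p &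
              weak_type mu (Mnc rho mu kappa) p <-> Pw p]].
Proof.
move=> k1 acs acw as_ aw scs wcw sw wc sw' wc' P2 P3.
have [Fc Fc_spec] := centered_family kappa k1 Pcs Pcw acs sw wc P2.
have [Fn [Fn_centered Fn_spec]] := noncentered_family kappa k1 Ps Pw as_ sw' wc' P3.
(* The first family destroys doubling, the second prescribes the centred exponents and the third the
   noncentred ones. *)
pose Bk := interleave (@pair_block R) Fc Fn.
have centered : family_spec kappa Bk true Pcs Pcw.
  have H := family_spec_interleave kappa _ _ _ true _ _ _ _ _ _
    (family_spec_pair kappa k1 true) (Fc_spec true) Fn_centered.
  by apply: (family_spec_ext kappa _ _ _ _ _ _ _ _ H) => p p1 /=; split=> [[[]]|].
have noncentered : family_spec kappa Bk false Ps Pw.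
  have H := family_spec_interleave kappa _ _ _ false _ _ _ _ _ _
    (family_spec_pair kappa k1 false) (Fc_spec false) Fn_spec.
  (* Intersecting with the centred sets changes nothing, by the inclusions [scs] and [wcw]. *)
  apply: (family_spec_ext kappa _ _ _ _ _ _ _ _ H) => p p1 /=; split => [[]//|Pp].
    by split => //; split => //; exact: scs.
  by split => //; split => //; exact: wcw.
exists default_measure_display, (glued R Bk), (gmu Bk), (grho Bk); split.
- exact: gmetric_measure_space.
- apply: gnot_doubling => C; have [n H] := pair_block_not_doubling C.
  exists (n * 3)%N; rewrite /Bk; have [-> _ _] := interleaveE (@pair_block R) Fc Fn n.
  exact: H.
move=> p p1.
have [cs cw] := glued_types Bk kappa k1 true _ _ p centered
  (admissible_oo _ acs) (admissible_oo _ acw) p1.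
have [ns nw] := glued_types Bk kappa k1 false _ _ p noncentered
  (admissible_oo _ as_) (admissible_oo _ aw) p1.
by split.
Qed.
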